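(* For a positive integer $k$, let $m^{OL}(k)$ be the smallest $N$ for which Presenter has a winning strategy in the on-line $2$-coloring game on $k$-uniform hypergraphs with $N$ edges. Then, as $k\to\infty$, $$m^{OL}(k) = \Theta(2^k).$$
   Context: On-line $2$-coloring game on $k$-uniform hypergraphs with $N$ edges. The game is played by Presenter and Colorer; the parameters $k$ (cardinality of edges) and $N$ (number of edges) are known to both players before the game. The $N$ edges are initially empty. In each round, Presenter reveals one new vertex and declares in which of the $N$ edges it is contained; Presenter cannot add vertices to edges which already contain $k$ vertices. Colorer must immediately assign color $0$ or $1$ to the presented vertex, and this color cannot be changed later. Presenter wins when there exists a monochromatic edge containing $k$ vertices. Colorer wins when all vertices have been revealed (i.e. all $N$ edges contain $k$ vertices each) and no edge is monochromatic. *)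

(* Defs.v *)
From mathcomp Require Import all_boot.
From mathcomp Require Import boolp.

Set Implicit Arguments.
Unset Strict Implicit.
Unset Printing Implicit Defensive.

Section Game.

Variables k N : nat.

(* A round [(A, c)]: the revealed vertex lies in exactly the edges in [A] and
   is coloured [c]. The vertices of a position are its rounds, oldest first;
   edges are labelled, so two of them may end up with the same vertices. *)
Definition round : Type := ({set 'I_N} * bool)%type.
Definition position : Type := seq round.

Definition edge (h : position) (e : 'I_N) : seq round :=
  [seq r : round <- h | e \in r.1].

Definition legal (h : position) (A : {set 'I_N}) : bool :=
  [forall e in A, size (edge h e) < k].

Definition presenter_won (h : position) : bool :=
  [exists e, (size (edge h e) == k) &&
    [exists c : bool, all (fun r : round => r.2 == c) (edge h e)]].

Definition presenter_strategy : Type := position -> {set 'I_N}.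
Definition colorer_strategy : Type := position -> {set 'I_N} -> bool.

Fixpoint play (P : presenter_strategy) (C : colorer_strategy) (n : nat) :
    position :=
  if n is n'.+1 then
    let h := play P C n' in rcons h (P h, C h (P h))
  else [::].

(* Legality is required only up to the winning round. A win of Colorer needs no
   separate clause: once all edges are full, the only legal move is [set0],
   which changes no edge. *)
Definition winning (P : presenter_strategy) : Prop :=
  forall C : colorer_strategy, exists n,
    presenter_won (play P C n) /\
    forall i, i < n -> legal (play P C i) (P (play P C i)).

Definition presenter_wins : Prop := exists P, winning P.

End Game.

(* The edges are all k-subsets of 2k-1 vertices, presented in a fixed order. *)
Lemma presenter_wins_exists (k : nat) : exists N, `[< presenter_wins k N >].
Proof.
pose m := (k + k).-1.
pose F := [set A : {set 'I_m} | #|A| == k].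
exists #|F|; apply/asboolP.
pose S (e : 'I_#|F|) := [seq val i | i <- enum (enum_val e)].
have S_uniq e : uniq (S e).
  by rewrite map_inj_uniq ?enum_uniq //; exact: val_inj.
have S_size e : size (S e) = k.
  by rewrite size_map -cardE; have := enum_valP e; rewrite inE => /eqP.
have S_lt e i : i \in S e -> i < m by case/mapP => j _ ->; exact: ltn_ord.
pose P : presenter_strategy #|F| := fun h => [set e | size h \in S e].
exists P => C; exists m.
pose col i := C (play P C i) (P (play P C i)).
have playE n : play P C n = [seq (P (play P C i), col i) | i <- iota 0 n].
  by elim: n => // n IH; rewrite -addn1 iotaD map_cat -IH /= addn1 cats1.
have size_play n : size (play P C n) = n by rewrite playE size_map size_iota.
have edgeE n e : edge (play P C n) e =
    [seq (P (play P C i), col i) | i <- [seq i <- iota 0 n | i \in S e]].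
  rewrite playE /edge filter_map; congr map; apply: eq_filter => i /=.
  by rewrite inE size_play.
split; last first.
  move=> n _; apply/forall_inP => e; rewrite inE size_play => nS.
  rewrite edgeE size_map -(S_size e) -[X in X < _]/(size _).
  apply: (@uniq_leq_size _ (n :: _)).
    by rewrite /= filter_uniq ?iota_uniq // mem_filter mem_iota ltnn !andbF.
  by move=> i; rewrite inE mem_filter => /predU1P[->|/andP[]].
pose D c := [set i : 'I_m | col i == c].
have [c cP] : exists c, k <= #|D c|.
  have : #|D true| + #|D false| = m.
    rewrite -[RHS]card_ord -(cardsC (D true)); congr (_ + #|pred_of_set _|).
    by apply/setP => i; rewrite !inE; case: (col i).
  case: (leqP k #|D true|) => [|lt_t]; first by exists true.
  case: (leqP k #|D false|) => [|lt_f]; first by exists false.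
  move=> Dm; have : #|D true|.+1 + #|D false|.+1 <= k + k by exact: leq_add.
  rewrite addSn addnS Dm => /leq_trans/(_ (leqSpred _)).
  by rewrite -/m ltnn.
have : 0 < #|[set B : {set 'I_m} | B \subset D c & #|B| == k]|.
  by rewrite cards_draws bin_gt0.
case/card_gt0P => B; rewrite inE => /andP[sBD kB].
have FB : B \in F by rewrite inE.
pose e := enum_rank_in FB B.
have SE : S e = [seq val i | i <- enum B] by rewrite /S enum_rankK_in.
apply/existsP; exists e; rewrite edgeE; apply/andP; split.
  rewrite size_map -[X in _ == X](S_size e); apply/eqP/perm_size.
  apply: uniq_perm; rewrite ?filter_uniq ?iota_uniq // => i.
  rewrite mem_filter mem_iota add0n /=.
  by case iS: (i \in S e); rewrite //= (S_lt _ _ iS).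
apply/existsP; exists c; rewrite all_map; apply/allP => i.
rewrite mem_filter SE => /andP[/mapP[j + ->] _]; rewrite mem_enum.
by move/(subsetP sBD); rewrite inE.
Qed.

Definition mOL (k : nat) : nat := ex_minn (presenter_wins_exists k).

(* Main.v *)
(* For the lower bound, Colorer never lets the expected number of monochromatic
   edges of a random completion increase.

   For the upper bound, Presenter hopes for colour [false] on one half of the
   edges and for colour [true] on the other half, and presents in every round
   the fraction [1 / T] of the live edges of each kind, separately for each
   number [i] of missing vertices. After [v] rounds won by the left edges and
   [u] lost by them, their number at distance [i] is, up to rounding,
   [2 ^ i (1 + 1 / T) ^ v (1 - 1 / T) ^ u] times an average of the initial
   densities over a binomial distribution with [v] trials, and symmetrically on
   the right. So a window of left edges around distance [D] of density
   [rho e ^ s], together with a window of right edges around distance [E] of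
   density [rho e ^ - s] with [E - D = 2 s], travels towards smaller [D + E]
   whatever Colorer does, and the only significant loss in [rho] is that due to
   the binomial spreading.

   When all edges start at distance [k], this first produces windows whose width
   is of the order of the square root of [k]. Later windows are cut into pieces
   much wider than the spreading during the next stage, in which [D + E] is
   divided by 64, so that the losses of all stages together are bounded. Windows
   at the same positions are merged, which does not decrease the total [rho]
   because [e ^ y + e ^ - y >= 2]. At bounded distances, a large constant density
   suffices to win by presenting one half of a group in every round. *)

From HB Require Import structures.
Require Import Defs.
From mathcomp Require Import all_boot all_order all_algebra.
From mathcomp Require Import boolp classical_sets reals.
From mathcomp Require Import topology normedtype landau sequences exp.
From mathcomp Require Import ring lra zify.
Import Order.TTheory GRing.Theory Num.Theory.

Set Implicit Arguments.
Unset Strict Implicit.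
Unset Printing Implicit Defensive.

Local Open Scope nat_scope.

(** * Positions: the strategy of Colorer, and bounded play of Presenter *)

Section Positions.
Variables k N : nat.
Implicit Types (h : position N) (A S : {set 'I_N}) (c : bool) (e : 'I_N).

Lemma edge_rcons h (r : round N) e :
  edge (rcons h r) e = if e \in r.1 then rcons (edge h e) r else edge h e.
Proof. by rewrite /edge filter_rcons. Qed.

Definition monochromatic h c e := all (fun r : round N => r.2 == c) (edge h e).

Lemma monochromatic_rcons h A c c' e : monochromatic (rcons h (A, c)) c' e =
  (if e \in A then (c == c') && monochromatic h c' e else monochromatic h c' e).
Proof. by rewrite /monochromatic edge_rcons /=; case: ifP => // _; rewrite all_rcons. Qed.

Lemma presenter_wonP h :
  reflect (exists e c, size (edge h e) = k /\ monochromatic h c e)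
          (presenter_won k h).
Proof.
apply: (iffP existsP) => [[e /andP[/eqP he /existsP[c hc]]]|[e [c [he hc]]]].
  by exists e, c.
by exists e; rewrite he eqxx; apply/existsP; exists c.
Qed.

(** Scaled by [2 ^ k], the probability that [e] ends up monochromatic when its missing vertices are
    coloured by fair coins. An empty edge counts for both colours and has weight 2. *)
Definition weight h e :=
  \sum_(c : bool) (if monochromatic h c e then 2 ^ size (edge h e) else 0).

Lemma weight_rcons h A e :
  weight (rcons h (A, true)) e + weight (rcons h (A, false)) e = 2 * weight h e.
Proof.
rewrite /weight !big_bool /= !monochromatic_rcons !edge_rcons /=.
case: (e \in A) => /=; last by rewrite mul2n addnn.
rewrite !size_rcons expnS; move: (2 ^ _) => w.
by case: monochromatic; case: monochromatic => /=; lia.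
Qed.

Definition total_weight h := \sum_e weight h e.

(* The conditional expectation argument: one of the two colours does not
   increase the expected number of monochromatic edges of a random completion
   (scaled by [2 ^ k]). *)
Lemma colorer_survives (P : presenter_strategy N) : 2 * N < 2 ^ k ->
  exists C, forall n, ~~ presenter_won k (play P C n).
Proof.
move=> Nk.
pose C h A := total_weight (rcons h (A, true)) <= total_weight h.
have step h A : total_weight (rcons h (A, C h A)) <= total_weight h.
  have : total_weight (rcons h (A, true)) + total_weight (rcons h (A, false)) =
         2 * total_weight h.
    rewrite /total_weight -big_split big_distrr /=.
    by apply: eq_bigr => e _; rewrite weight_rcons.
  by rewrite /C; case: (leqP (total_weight (rcons h (A, true)))) => /=; lia.
have small n : total_weight (play P C n) <= 2 * N.
  elim: n => [|n]; last by apply: leq_trans; exact: step.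
  rewrite /total_weight (eq_bigr (fun=> 2)) => [|e _]; last first.
    by rewrite /weight big_bool.
  by rewrite sum_nat_const card_ord mulnC.
exists C => n; apply/negP => /presenter_wonP[e [c [se ce]]].
suff : 2 ^ k <= total_weight (play P C n) by have := small n; lia.
rewrite /total_weight (bigD1 e) //= /weight (bigD1 c) //= ce se; lia.
Qed.

Fixpoint wins_within n h : Prop :=
  presenter_won k h \/
  if n is n'.+1 then
    exists A, legal k h A /\ forall c, wins_within n' (rcons h (A, c))
  else False.

Lemma wins_within_leq m n h : m <= n -> wins_within m h -> wins_within n h.
Proof.
elim: m n h => [|m IH] n h mn; first by case=> // won; case: n {mn} => [|n]; left.
case: n mn => // n mn /= [won|[A [lA win]]]; first by left.
by right; exists A; split=> // c; exact: IH.
Qed.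

(** A good set is chosen classically in every position that has one. A strategy sees only the
    position, so the number of remaining rounds is recovered as [n - size h]. *)
Lemma wins_within_presenter n : wins_within n [::] -> presenter_wins k N.
Proof.
move=> win0.
pose good h A := legal k h A /\
  forall c, wins_within (n - size h).-1 (rcons h (A, c)).
pose P : presenter_strategy N := fun h =>
  if pselect (exists A, good h A) is left ex then projT1 (cid ex) else finset.set0.
have PP h : (exists A, good h A) -> good h (P h).
  by rewrite /P; case: pselect => // ex _; exact: projT2 (cid ex).
exists P => C.
have size_play i : size (play P C i) = i by elim: i => //= i IH; rewrite size_rcons IH.
suff main m i : m = n - i -> i <= n -> wins_within m (play P C i) ->
    (forall j, j < i -> legal k (play P C j) (P (play P C j))) ->
    exists n0, presenter_won k (play P C n0) /\
      forall j, j < n0 -> legal k (play P C j) (P (play P C j)).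
  by apply: (main n 0); rewrite ?subn0.
elim: m i => [|m IH] i mi ni /=; first by move=> [won|//] leg; exists i.
case=> [won leg|[A gA] leg]; first by exists i.
have gA' : good (play P C i) A by rewrite /good size_play -mi.
have [lP wP] := PP (play P C i) (ex_intro _ A gA').
apply: (IH i.+1); try lia.
  by have := wP (C (play P C i) (P (play P C i))); rewrite size_play -mi.
by move=> j; rewrite ltnS leq_eqVlt => /predU1P[->|/leg].
Qed.

End Positions.

(** * The game in terms of chips *)

Definition counts := nat -> nat.

(* A chip at distance [i] is an edge still lacking [i] vertices of its colour:
   [false] for the left chips, [true] for the right ones. The presented chips
   [X] and [Y] cannot both advance; those on the losing side are dead. *)
Definition keep (L X : counts) : counts := fun i => L i - X i.
Definition push (L X : counts) : counts := fun i => L i - X i + X i.+1.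

(** Being inductive, it allows only finitely many rounds before [Q] or a chip at distance 0 is
    reached. The first subgame of [ForceMove] answers colour [false], the second colour [true]. *)
Inductive force (Q : counts -> counts -> Prop) : counts -> counts -> Prop :=
| ForceDone L R : Q L R -> force Q L R
| ForceGoal L R : (0 < L 0) || (0 < R 0) -> force Q L R
| ForceMove L R X Y : (forall i, X i <= L i) -> (forall i, Y i <= R i) ->
    force Q (push L X) (keep R Y) -> force Q (keep L X) (push R Y) ->
    force Q L R.

Definition lec (L M : counts) := forall i, L i <= M i.
Definition addc (L M : counts) : counts := fun i => L i + M i.

Definition upclosed (Q : counts -> counts -> Prop) :=
  forall L R L' R', lec L L' -> lec R R' -> Q L R -> Q L' R'.

(** The chips [L0] and [R0] lie idle during the play for [Q] and remain available for the play for
    [Q']. This lets separate groups be played one after the other. *)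
Lemma force_frame Q Q' (L0 R0 : counts) : upclosed Q' ->
  (forall L R, Q L R -> force Q' (addc L L0) (addc R R0)) ->
  forall L R, force Q L R -> force Q' (addc L L0) (addc R R0).
Proof.
move=> upQ' QQ'.
suff mono L R : force Q' L R ->
    forall L' R', lec L L' -> lec R R' -> force Q' L' R'.
  move=> L R; elim=> {L R} [L R /QQ'//|L R g|L R X Y XL YR _ IH1 _ IH2].
    by apply: ForceGoal; rewrite /addc; lia.
  apply: (@ForceMove _ _ _ X Y) => [i|i||].
  - by rewrite /addc; have := XL i; lia.
  - by rewrite /addc; have := YR i; lia.
  - apply: (mono _ _ IH1) => i; rewrite /push /keep /addc.
      by have := XL i; lia.
    by have := YR i; lia.
  - apply: (mono _ _ IH2) => i; rewrite /push /keep /addc.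
      by have := XL i; lia.
    by have := YR i; lia.
elim=> {L R} [L R q|L R g|L R X Y XL YR _ IH1 _ IH2] L' R' LL' RR'.
- by apply: ForceDone; exact: upQ' q.
- by apply: ForceGoal; have := LL' 0; have := RR' 0; lia.
- apply: (@ForceMove _ _ _ X Y) => [i|i||].
  + by have := XL i; have := LL' i; lia.
  + by have := YR i; have := RR' i; lia.
  + apply: IH1 => i; rewrite /push /keep.
      by have := XL i; have := LL' i; lia.
    by have := YR i; have := RR' i; lia.
  + apply: IH2 => i; rewrite /push /keep.
      by have := XL i; have := LL' i; lia.
    by have := YR i; have := RR' i; lia.
Qed.

Lemma force_bind Q Q' L R : upclosed Q' ->
  (forall L R, Q L R -> force Q' L R) -> force Q L R -> force Q' L R.
Proof.
move=> upQ' QQ'; elim=> {L R} [L R /QQ'//|L R g|L R X Y XL YR _ IH1 _ IH2].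
  exact: ForceGoal.
exact: (@ForceMove _ _ _ X Y).
Qed.

Lemma force_mono Q L R L' R' : upclosed Q -> lec L L' -> lec R R' ->
  force Q L R -> force Q L' R'.
Proof.
move=> upQ LL' RR' f.
pose L0 i := L' i - L i; pose R0 i := R' i - R i.
have eL : addc L L0 = L'.
  by apply/funext => i; rewrite /addc /L0; have := LL' i; lia.
have eR : addc R R0 = R'.
  by apply/funext => i; rewrite /addc /R0; have := RR' i; lia.
rewrite -eL -eR; apply: force_frame f => // L1 R1 q.
by apply: ForceDone; apply: upQ q => i; rewrite /addc leq_addr.
Qed.

Definition nowhere (L R : counts) := False.

Lemma upclosed_nowhere : upclosed nowhere. Proof. by []. Qed.

(* Presenting half of either group loses a factor two on the side which is
   killed but advances the other one. *)
Lemma crude_win D E (L R : counts) :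
  2 ^ (D + E) <= L D -> 2 ^ (D + E) <= R E -> force nowhere L R.
Proof.
have [n] := ubnP (D + E); elim: n => // n IH in D E L R * => ltn lL lR.
case: D => [|D] in ltn lL lR *.
  by apply: ForceGoal; rewrite (leq_trans _ lL) ?expn_gt0.
case: E => [|E] in ltn lL lR *.
  by apply: ForceGoal; rewrite orbC (leq_trans _ lR) ?expn_gt0.
have e1 : 2 ^ (D.+1 + E.+1) = 2 * 2 ^ (D + E.+1) by rewrite addSn expnS.
have e2 : 2 ^ (D.+1 + E) = 2 ^ (D + E.+1) by rewrite addSnnS.
apply: (@ForceMove _ _ _ (fun i => if i == D.+1 then 2 ^ (D + E.+1) else 0)
                         (fun i => if i == E.+1 then 2 ^ (D + E.+1) else 0)).
- by move=> i; case: eqP => // ->; lia.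
- by move=> i; case: eqP => // ->; lia.
- apply: (IH D E.+1) => //; rewrite /push /keep ?eqxx; lia.
- apply: (IH D.+1 E); rewrite /push /keep ?eqxx; lia.
Qed.

(** * From chips back to edges *)

Section Link.
Variables k N : nat.
Implicit Types (h : position N) (A B : {set 'I_N}) (c : bool) (e : 'I_N).

Definition some_subset A n := [set e in take n (enum A)].

Lemma some_subset_sub A n : some_subset A n \subset A.
Proof. by apply/fintype.subsetP => e; rewrite inE => /mem_take; rewrite mem_enum. Qed.

Lemma card_some_subset A n : n <= #|A| -> #|some_subset A n| = n.
Proof.
move=> nA; rewrite cardsE (card_uniqP _) ?take_uniq ?enum_uniq //.
by rewrite size_takel // -cardE.
Qed.

Variable S : {set 'I_N}.

Definition side c := if c then ~: S else S.

Definition chips h c i :=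
  [set e in side c | monochromatic h c e && (size (edge h e) + i == k)].

Lemma side_disjoint c e : e \in side c -> e \in side (~~ c) -> False.
Proof. by case: c => /=; rewrite finset.in_setC => h1 h2; [rewrite h2 in h1|rewrite h1 in h2]. Qed.

Lemma chips_won h c e : e \in chips h c 0 -> presenter_won k h.
Proof.
rewrite inE addn0 => /and3P[_ ce /eqP se].
by apply/presenter_wonP; exists e, c.
Qed.

Section Move.
Variables (h : position N) (X : bool -> counts).
Hypothesis X_le : forall c i, X c i <= #|chips h c i|.

Definition presented := [set e | [exists c : bool,
  e \in some_subset (chips h c (k - size (edge h e))) (X c (k - size (edge h e)))]].

Lemma presented_chips c i e : e \in chips h c i ->
  (e \in presented) = (e \in some_subset (chips h c i) (X c i)).
Proof.
move=> ech; have := ech; rewrite inE => /and3P[eS _ /eqP sz].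
have -> : i = k - size (edge h e) by lia.
rewrite inE; apply/existsP/idP => [[c' hc']|]; last by exists c.
have [->//|cc'] := eqVneq c c'.
have /(fintype.subsetP (some_subset_sub _ _)) := hc'; rewrite inE => /andP[eS' _].
by case: (@side_disjoint c e) => //; have -> : ~~ c = c' by case: c c' cc' {hc' eS' eS ech} => [] [].
Qed.

Lemma presented_legal : ~~ presenter_won k h -> legal k h presented.
Proof.
move=> nw; apply/forall_inP => e; rewrite inE => /existsP[c].
move/(fintype.subsetP (some_subset_sub _ _)) => ech; move: (ech).
rewrite inE => /and3P[_ _ /eqP sz].
rewrite ltnNge; apply/negP => ge; case/negP: nw; apply: (@chips_won _ c e).
by move: ech; have -> : k - size (edge h e) = 0 by lia.
Qed.

Lemma chips_killed c i :
  #|chips h c i| - X c i <= #|chips (rcons h (presented, ~~ c)) c i|.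
Proof.
rewrite -{1}(card_some_subset (X_le c i)) -cardsDS ?some_subset_sub //.
apply/subset_leq_card/fintype.subsetP => e; rewrite inE => /andP[enot ech].
have /negPf enP : e \notin presented by rewrite (presented_chips ech).
by move: ech; rewrite !inE monochromatic_rcons edge_rcons enP.
Qed.

Lemma chips_pushed c i :
  #|chips h c i| - X c i + X c i.+1 <=
    #|chips (rcons h (presented, c)) c i|.
Proof.
rewrite -{1}(card_some_subset (X_le c i)) -cardsDS ?some_subset_sub //.
rewrite -(card_some_subset (X_le c i.+1)).
set B := some_subset _ _; set B' := some_subset _ _.
have sB' : B' \subset chips h c i.+1 by exact: some_subset_sub.
rewrite -cardsUI (_ : (_ :\: B) :&: B' = finset.set0) ?finset.cards0 ?addn0.
  apply/subset_leq_card/fintype.subsetP => e; rewrite inE => /orP[|eB'].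
    rewrite inE => /andP[enot ech].
    have /negPf enP : e \notin presented by rewrite (presented_chips ech).
    by move: ech; rewrite !inE monochromatic_rcons edge_rcons enP.
  have ech := fintype.subsetP sB' e eB'.
  have eP : e \in presented by rewrite (presented_chips ech).
  move: ech; rewrite !inE monochromatic_rcons edge_rcons eP /= size_rcons eqxx.
  by rewrite addSnnS.
apply/setP => e; rewrite finset.in_setI finset.in_setD finset.in_set0; apply/negP.
move=> /andP[/andP[_]]; rewrite inE => /and3P[_ _ /eqP sz] eB'.
by have := fintype.subsetP sB' e eB'; rewrite inE => /and3P[_ _ /eqP]; lia.
Qed.

End Move.

(** The counts need only bound the numbers of live edges from below, so forgotten edges do no harm.
    Positions already won are treated first, since presenting an edge at distance 0 would be
    illegal. *)
Lemma force_wins L R : force nowhere L R -> forall h,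
  (forall i, L i <= #|chips h false i|) -> (forall i, R i <= #|chips h true i|) ->
  exists n, wins_within k n h.
Proof.
elim=> {L R} [L R []|L R g|L R X Y XL YR _ IH1 _ IH2] h hL hR.
  exists 0; left; case/orP: g => [g|g].
    have /card_gt0P[e] : 0 < #|chips h false 0| by exact: leq_trans (hL 0).
    exact: chips_won.
  have /card_gt0P[e] : 0 < #|chips h true 0| by exact: leq_trans (hR 0).
  exact: chips_won.
have [won|nw] := boolP (presenter_won k h); first by exists 0; left.
pose Z c := if c then Y else X.
have Z_le c i : Z c i <= #|chips h c i|.
  by case: c => /=; [exact: leq_trans (YR i) _|exact: leq_trans (XL i) _].
have [n1 w1] : exists n, wins_within k n (rcons h (presented h Z, false)).
  apply: IH1 => i.
    apply: leq_trans (chips_pushed Z_le false i); rewrite /push /=.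
    by rewrite leq_add2r leq_sub2r.
  apply: leq_trans (chips_killed Z_le true i); rewrite /keep /=.
  by rewrite leq_sub2r.
have [n2 w2] : exists n, wins_within k n (rcons h (presented h Z, true)).
  apply: IH2 => i.
    apply: leq_trans (chips_killed Z_le false i); rewrite /keep /=.
    by rewrite leq_sub2r.
  apply: leq_trans (chips_pushed Z_le true i); rewrite /push /=.
  by rewrite leq_add2r leq_sub2r.
exists (maxn n1 n2).+1; right; exists (presented h Z); split.
  exact: presented_legal.
by case; [apply: wins_within_leq w2 | apply: wins_within_leq w1]; lia.
Qed.

End Link.

Definition single (k n : nat) : counts := fun i => if i == k then n else 0.

Lemma presenter_wins_of_force k n :
  force nowhere (single k n) (single k n) -> presenter_wins k (n + n).
Proof.
move=> f; pose S := [set e : 'I_(n + n) | e < n].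
have cS : #|S| = n.
  have -> : S = [set lshift n i | i in [set: 'I_n]].
    apply/setP => e; rewrite inE; apply/idP/imsetP => [en|[i _ ->]].
      by exists (Ordinal en) => //; exact: val_inj.
    by rewrite /= ltn_ord.
  by rewrite card_imset ?cardsT ?card_ord //; exact: lshift_inj.
suff [m] : exists m, wins_within k m ([::] : position (n + n)).
  exact: wins_within_presenter.
apply: (force_wins (S := S) f) => i; rewrite /single; case: eqP => // ->.
  rewrite -[leqLHS]cS; apply/subset_leq_card/fintype.subsetP => e.
  by rewrite !inE add0n eqxx => ->.
have cC : #|~: S| = n by rewrite cardsCs finset.setCK card_ord cS addnK.
rewrite -[leqLHS]cC; apply/subset_leq_card/fintype.subsetP => e.
by rewrite !inE add0n eqxx => ->.
Qed.

Local Open Scope ring_scope.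

(** * Presenting a fixed fraction of all chips *)

Section Averaging.
Variable R : realType.
Implicit Types (q : R) (g : nat -> R).

(** [iter n (avg q) g i] is the expectation of [g (i + B)] for [B] binomial with [n] trials of
    success probability [q]. *)
Definition avg q g i := (1 - q) * g i + q * g i.+1.

Lemma iter_avg_le q g g' n : 0 <= q <= 1 -> (forall i, g i <= g' i) ->
  forall i, iter n (avg q) g i <= iter n (avg q) g' i.
Proof.
move=> /andP[q0 q1] gg'; elim: n => //= n IH i; rewrite /avg.
by rewrite lerD // ler_wpM2l ?subr_ge0.
Qed.

(** The second moment of the binomial distribution about [m]: squared bias plus the variance
    [n q (1 - q)]. *)
Lemma iter_avg_parabola q (a b m : R) n i :
  iter n (avg q) (fun j => a - b * (j%:R - m) ^+ 2) i =
  a - b * ((i%:R + n%:R * q - m) ^+ 2 + n%:R * q * (1 - q)).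
Proof.
elim: n i => [|n IH] i /=; first by ring.
by rewrite /avg !IH -!natr1; ring.
Qed.

(* Chebyshev's inequality for the binomial distribution, by comparing the
   indicator function of a window with a parabola below it. *)
Lemma iter_avg_window q (P : pred nat) n (H : R) i : 0 <= q <= 1 -> 0 < H ->
  (forall j : nat, `|j%:R - (i%:R + n%:R * q)| < H -> P j) ->
  1 - n%:R * q / H ^+ 2 <= iter n (avg q) (fun j => (P j)%:R) i.
Proof.
move=> q01 H0 HP; have /andP[q0 q1] := q01.
pose m : R := i%:R + n%:R * q.
apply: le_trans (iter_avg_le n q01 _ i); last first.
  move=> j; instantiate (1 := fun j => 1 - (H ^+ 2)^-1 * (j%:R - m) ^+ 2).
  have [/HP -> | jm] := ltP `|j%:R - m| H.
    by rewrite gerBl mulr_ge0 ?invr_ge0 ?sqr_ge0.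
  apply: le_trans (ler0n _ _); rewrite subr_le0 ler_pdivlMl ?exprn_gt0 // mulr1.
  by rewrite -(real_normK (num_real (j%:R - m))) lerXn2r ?nnegrE // ltW.
rewrite iter_avg_parabola /m subrr expr0n add0r lerB // [leRHS]mulrC.
by rewrite ler_wpM2l ?invr_ge0 ?sqr_ge0 // ler_piMr ?mulr_ge0 // gerBl.
Qed.

End Averaging.

Section Uniform.
Variable R : realType.

Variables (T : nat).
Hypothesis T_gt1 : (1 < T)%N.

Let th : R := T%:R^-1.
Let q : R := 2 / T.+1%:R.

Let T_gt0 : 0 < T%:R :> R. Proof. by rewrite ltr0n; lia. Qed.
Let thT : th * T%:R = 1. Proof. by rewrite mulVf // lt0r_neq0. Qed.

Lemma divn_bounds (n : nat) :
  (n %/ T)%:R <= th * n%:R :> R /\ th * n%:R - 1 <= (n %/ T)%:R :> R.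
Proof.
have e : n%:R = (n %/ T)%:R * T%:R + (n %% T)%:R :> R.
  by rewrite -natrM -natrD -divn_eq.
have th0 : 0 < th by rewrite invr_gt0.
have r0 : 0 <= (n %% T)%:R :> R by [].
have r1 : (n %% T)%:R <= T%:R :> R by rewrite ler_nat ltnW // ltn_mod; lia.
have e' : th * n%:R = (n %/ T)%:R + th * (n %% T)%:R.
  by rewrite e mulrDr mulrCA thT mulr1.
have s1 : th * (n %% T)%:R <= 1 by rewrite -[leRHS]thT ler_pM2l.
have s0 : 0 <= th * (n %% T)%:R by rewrite pmulr_rge0.
by split; lra.
Qed.

Lemma keep_bound (L : counts) (f : nat -> R) c i : 0 <= c ->
  (forall i, f i - c <= (L i)%:R) ->
  (1 - th) * f i - (c + 1) <= (keep L (fun i => L i %/ T)%N i)%:R.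
Proof.
move=> c0 fL; have [u _] := divn_bounds (L i).
rewrite /keep natrB ?leq_div //.
have th01 : 0 <= th <= 1.
  by rewrite invr_ge0 ltW //= invf_le1 // ler1n ltnW.
by have := fL i; nra.
Qed.

(** The two weights sum to 1, so the inherited error does not grow; only rounding down the arriving
    group adds to it, by at most 1. *)
Lemma push_bound (L : counts) (f : nat -> R) c i : 0 <= c ->
  (forall i, f i - c <= (L i)%:R) ->
  (1 - th) * f i + th * f i.+1 - (c + 1) <=
    (push L (fun i => L i %/ T)%N i)%:R.
Proof.
move=> c0 fL; have [u _] := divn_bounds (L i).
have [_ u'] := divn_bounds (L i.+1).
rewrite /push natrD natrB ?leq_div //.
have th01 : 0 <= th <= 1.
  by rewrite invr_ge0 ltW //= invf_le1 // ler1n ltnW.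
by have := fL i; have := fL i.+1; nra.
Qed.

(* The number of chips at distance [i] if exactly the fraction [th] of every
   group is presented, [v] times successfully and [u] times in vain. *)
Definition profile (c : R) g (v u i : nat) : R :=
  2 ^+ i * (c * ((1 + th) ^+ v * (1 - th) ^+ u)) * iter v (avg q) g i.

Lemma profile_keep c g v u i :
  profile c g v u.+1 i = (1 - th) * profile c g v u i.
Proof. by rewrite /profile exprSr; ring. Qed.

(** With [2 ^ i] split off, the weights are [1 - th] and [2 * th]. Their sum [1 + th] is the growth
    factor, and normalising leaves the success probability [2 * th / (1 + th) = q]. *)
Lemma profile_push c g v u i : profile c g v.+1 u i =
  (1 - th) * profile c g v u i + th * profile c g v u i.+1.
Proof.
have q1 : (1 + th) * q = 2 * th.
  rewrite /q -[T.+1%:R]natr1 /th; have := T_gt0; move: (T%:R : R) => y y0.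
  by field; rewrite !lt0r_neq0 // addr_gt0.
rewrite /profile /= /avg !exprSr.
transitivity (2 ^+ i * (c * ((1 + th) ^+ v * (1 - th) ^+ u)) *
  ((1 + th - (1 + th) * q) * iter v (avg q) g i +
   (1 + th) * q * iter v (avg q) g i.+1)); first by ring.
by rewrite q1; ring.
Qed.

(** The play stops after [t] rounds, or earlier once the mean distance [2 v / (T + 1)] travelled on
    the left reaches [D] or its counterpart on the right reaches [E]. The initial error is 1, and
    every round adds at most 1. *)
Lemma uniform_play (D E t : nat) Q gL gR lam mu (L0 R0 : counts) :
  (forall i, 2 ^+ i * lam * gL i - 1 <= (L0 i)%:R) ->
  (forall i, 2 ^+ i * mu * gR i - 1 <= (R0 i)%:R) ->
  (forall v u L R',
     (v + u <= t)%N -> (v * 2 <= D * T.+1 + 2)%N -> (u * 2 <= E * T.+1 + 2)%N ->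
     [|| v + u == t, D * T.+1 <= v * 2 | E * T.+1 <= u * 2]%N ->
     (forall i, profile lam gL v u i - t.+1%:R <= (L i)%:R) ->
     (forall i, profile mu gR u v i - t.+1%:R <= (R' i)%:R) ->
     force Q L R') ->
  force Q L0 R0.
Proof.
move=> hL0 hR0 stop.
suff main n v u L R' : n = (t - (v + u))%N -> (v + u <= t)%N ->
    (v * 2 <= D * T.+1 + 2)%N -> (u * 2 <= E * T.+1 + 2)%N ->
    (forall i, profile lam gL v u i - (v + u).+1%:R <= (L i)%:R) ->
    (forall i, profile mu gR u v i - (v + u).+1%:R <= (R' i)%:R) ->
    force Q L R'.
  apply: (main t 0%N 0%N); rewrite ?subn0 // => i.
    by rewrite /profile !expr0 !mulr1 /=.
  by rewrite /profile !expr0 !mulr1 /=.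
elim: n v u L R' => [|n IH] v u L R' nE vut vD uE hL hR.
  have vu : (v + u = t)%N by lia.
  by apply: (stop v u) => //; rewrite ?vu ?eqxx //; move: hL hR; rewrite vu.
have [st|] := boolP [|| v + u == t, D * T.+1 <= v * 2 | E * T.+1 <= u * 2]%N.
  apply: (stop v u) => // i; [apply: le_trans (hL i)|apply: le_trans (hR i)].
    by rewrite lerB // ler_nat; lia.
  by rewrite lerB // ler_nat; lia.
rewrite !negb_or -!ltnNge => /and3P[_ vD' uE'].
have vu0 : 0 <= (v + u).+1%:R :> R by [].
apply: (@ForceMove _ _ _ (fun i => L i %/ T)%N (fun i => R' i %/ T)%N).
- by move=> i; exact: leq_div.
- by move=> i; exact: leq_div.
- apply: (IH v.+1 u); rewrite ?addSn; try lia.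
    by move=> i; rewrite profile_push -[(v + u).+2%:R]natr1 push_bound.
  by move=> i; rewrite profile_keep -[(v + u).+2%:R]natr1 keep_bound.
- apply: (IH v u.+1); rewrite ?addnS; try lia.
    by move=> i; rewrite profile_keep -[(v + u).+2%:R]natr1 keep_bound.
  by move=> i; rewrite profile_push -[(v + u).+2%:R]natr1 push_bound.
Qed.

End Uniform.

(** * Exponential estimates *)

Section Exponential.
Variable R : realType.

Lemma expR_prodD (x y : R) v u : expR (x * v%:R + y * u%:R) = expR x ^+ v * expR y ^+ u.
Proof. by rewrite expRD !expRM_natr. Qed.

(** [e ^ 0.2 <= 1 / 0.8], and [1.25 ^ 3 < 2]. *)
Lemma expR_le2 : expR (6 / 10) <= 2 :> R.
Proof.
have h : (8 / 10 : R) <= expR (- (2 / 10)).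
  by apply: le_trans (expR_ge1Dx _); lra.
have p : expR (- (2 / 10)) * expR (2 / 10) = 1 :> R by rewrite -expRD addNr expR0.
have p0 := expR_gt0 (2 / 10 : R).
have h' : expR (2 / 10) <= 125 / 100 :> R by nra.
have -> : 6 / 10 = 2 / 10 * 3%:R :> R by lra.
rewrite expRM_natr.
have h3 : expR (2 / 10) ^+ 3 <= (125 / 100) ^+ 3 :> R.
  by rewrite lerXn2r ?nnegrE ?expR_ge0 //; lra.
by apply: le_trans h3 _; lra.
Qed.

Lemma expR_le_exp2 (n : nat) : expR (6 / 10 * n%:R) <= 2 ^+ n :> R.
Proof. by rewrite expRM_natr lerXn2r ?nnegrE ?expR_ge0 // expR_le2. Qed.

(** Each factor is bounded separately, by [1 + x >= e ^ (x - 2 x ^ 2)] and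
    [1 - x >= e ^ (- x - 2 x ^ 2)]. For [x = 1 / T] the second-order loss stays bounded during
    [O(T ^ 2)] rounds. *)
Lemma growth_bound (x : R) v u : 0 <= x <= 1 / 2 ->
  expR (x * (v%:R - u%:R) - 2 * (v + u)%:R * x ^+ 2) <=
    (1 + x) ^+ v * (1 - x) ^+ u.
Proof.
move=> /andP[x0 x1].
have -> : x * (v%:R - u%:R) - 2 * (v + u)%:R * x ^+ 2 =
    (x - 2 * x ^+ 2) * v%:R + (- x - 2 * x ^+ 2) * u%:R.
  by rewrite natrD; ring.
rewrite expR_prodD.
have x20 : 0 <= x ^+ 2 by exact: sqr_ge0.
have x2 : x ^+ 2 <= x / 2 by rewrite expr2; nra.
have xx : x ^+ 2 = x * x by rewrite expr2.
have inv (y z : R) : 0 < z -> 1 <= z * (1 + y) -> expR (- y) <= z.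
  move=> z0 zy; have e1 : expR y * expR (- y) = 1 by rewrite -expRD addrN expR0.
  have zE : 1 <= z * expR y by apply: le_trans zy _; rewrite ler_pM2l // expR_ge1Dx.
  by rewrite -[leRHS]mulr1 -e1 mulrA ler_peMl ?expR_ge0.
rewrite ler_pM ?exprn_ge0 ?expR_ge0 //.
  rewrite lerXn2r ?nnegrE ?expR_ge0 //; first lra.
  rewrite -[x - _]opprK; apply: inv; first lra.
  by nra.
rewrite lerXn2r ?nnegrE ?expR_ge0 //; first lra.
rewrite (_ : - x - _ = - (x + 2 * x ^+ 2)); last by ring.
by apply: inv; nra.
Qed.

End Exponential.

(** * Pairs of windows and their travel *)

Section Travel.
Variable R : realType.

(** A left and a right window of a common width, which is given separately. Densities are relative
    to [2 ^ i]: [dens * expR tilt] on the left and [dens * expR (- tilt)] on the right. *)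
Record item := Item { lpos : nat; rpos : nat; dens : R; tilt : R }.

Definition window_count (w D : nat) (c : R) (i : nat) : R :=
  if (D <= i < D + w)%N then 2 ^+ i * c else 0.

Lemma window_count_ge0 w D c i : 0 <= c -> 0 <= window_count w D c i.
Proof.
by move=> c0; rewrite /window_count; case: ifP => // _; rewrite mulr_ge0 ?exprn_ge0.
Qed.

Definition lcover w it := window_count w (lpos it) (dens it * expR (tilt it)).
Definition rcover w it := window_count w (rpos it) (dens it * expR (- tilt it)).

(** The slacks 10 and 1 absorb the rounding of positions. The upper bound on the sum leaves finitely
    many pairs of positions, on which merging relies. *)
Definition valid (S : nat) it :=
  [/\ (0 < lpos it)%N, (0 < rpos it)%N,
      (S <= lpos it + rpos it <= S + 10)%N, 0 < dens it &
      `|(rpos it)%:R - (lpos it)%:R - 2 * tilt it| <= 1].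

Definition contains w it (L R' : counts) :=
  (forall i, lcover w it i <= (L i)%:R) /\ (forall i, rcover w it i <= (R' i)%:R).

(* The relation [rpos - lpos = 2 tilt] between the two distances and the ratio
   of the two densities guarantees that no group of chips is too small. *)
Lemma group_size (D E S i : nat) (s : R) : (S <= D + E)%N -> (D <= i)%N ->
  E%:R - D%:R - 2 * s <= 1 -> expR (S%:R / 10 - 1 / 2) <= 2 ^+ i * expR s.
Proof.
move=> SDE Di h; apply: (@le_trans _ _ (expR (6 / 10 * i%:R + s))).
  rewrite ler_expR.
  have : S%:R <= D%:R + E%:R :> R by rewrite -natrD ler_nat.
  have : D%:R <= i%:R :> R by rewrite ler_nat.
  have : 0 <= E%:R :> R by [].
  lra.
by rewrite expRD ler_wpM2r ?expR_ge0 // expR_le_exp2.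
Qed.

(** Here [rho] and [y] are the old density and tilt, [a] and [b] the new ones, [G] is the growth and
    [x] the binomial average. The group has at least [expR (S / 10 - 1 / 2)] chips per unit of [a],
    so the rounding error [t] can be charged to the density. *)
Lemma cover_lower (S t i : nat) (a b rho eta loss x y G : R) :
  0 <= rho -> 0 <= eta ->
  a + t%:R * expR (1 / 2 - S%:R / 10) <= rho * eta * expR (- loss) ->
  eta <= x -> expR (b - y - loss) <= G ->
  expR (S%:R / 10 - 1 / 2) <= 2 ^+ i * expR b ->
  2 ^+ i * (a * expR b) <= 2 ^+ i * (rho * expR y * G) * x - t%:R.
Proof.
move=> rho0 eta0 ha hx hG hsz.
set p : R := 2 ^+ i in hsz *; have p0 : 0 < p by rewrite exprn_gt0.
set B := expR b in hsz *; have B0 : 0 < B by exact: expR_gt0.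
have hG' : B * expR (- loss) <= expR y * G.
  have -> : B * expR (- loss) = expR y * expR (b - y - loss).
    by rewrite /B -!expRD; congr expR; ring.
  by rewrite ler_wpM2l ?expR_ge0.
have t1 : t%:R <= p * B * (t%:R * expR (1 / 2 - S%:R / 10)) :> R.
  have e1 : expR (S%:R / 10 - 1 / 2) * expR (1 / 2 - S%:R / 10) = 1 :> R.
    by rewrite -expRD -[RHS]expR0; congr expR; ring.
  apply: (@le_trans _ _ (expR (S%:R / 10 - 1 / 2) *
                         (t%:R * expR (1 / 2 - S%:R / 10)))).
    by rewrite mulrCA e1 mulr1.
  by apply: ler_wpM2r => //; rewrite mulr_ge0 ?expR_ge0.
have h2 : p * B * (rho * eta * expR (- loss)) <= p * (rho * expR y * G) * x.
  have -> : p * B * (rho * eta * expR (- loss)) =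
      (p * rho) * ((B * expR (- loss)) * eta) by ring.
  have -> : p * (rho * expR y * G) * x = (p * rho) * ((expR y * G) * x) by ring.
  rewrite ler_wpM2l ?mulr_ge0 //; first exact: ltW.
  by rewrite ler_pM // mulr_ge0 ?expR_ge0 // ltW.
have h3 : p * B * (a + t%:R * expR (1 / 2 - S%:R / 10)) <=
          p * B * (rho * eta * expR (- loss)).
  by rewrite ler_wpM2l // mulr_ge0 // ltW.
have : p * (a * B) = p * B * a by ring.
lra.
Qed.

End Travel.

Local Open Scope nat_scope.

Lemma early_stop_window (D E S t T v w : nat) :
  S * T.+1 + 2 * t <= (D + E) * T.+1 -> 1 < T ->
  D * T.+1 <= v * 2 -> v * 2 <= D * T.+1 + 2 ->
  [/\ 2 * t <= v * 2 + E * T.+1, D * T.+1 <= 0 * T.+1 + v * 2 &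
      0 * T.+1 + v * 2 <= (D + w + 3) * T.+1].
Proof.
rewrite !mulnDl mul0n add0n; move: (S * _) (D * _) (E * _) (w * _) => s d e x.
by split; lia.
Qed.

(** Chips now at distance [i] have mean origin [i + 2 v / (T + 1)]. Rounding down to [a0] and the
    correction [a] make it exceed the old window by less than 3. *)
Lemma final_window (D T v w a i : nat) : let a0 := (v * 2) %/ T.+1 in
  a <= 2 -> v * 2 < D * T.+1 -> D - a0 + a <= i < D - a0 + a + w ->
  D * T.+1 <= i * T.+1 + v * 2 /\ i * T.+1 + v * 2 <= (D + w + 3) * T.+1.
Proof.
move=> a0 a2 vD /andP[i1 i2].
have va := leq_trunc_div (v * 2) T.+1; have va' := ltn_ceil (v * 2) (ltn0Sn T).
have aD : a0 < D by rewrite ltn_divLR.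
rewrite -/a0 in va va'.
have h1 : (D - a0) * T.+1 <= i * T.+1 by rewrite leq_mul2r; lia.
have h2 : i * T.+1 <= (D - a0 + w + 1) * T.+1 by rewrite leq_mul2r; lia.
have e : (D - a0) * T.+1 = D * T.+1 - a0 * T.+1 by rewrite mulnBl.
have h3 : a0 * T.+1 <= D * T.+1 by rewrite leq_mul2r ltnW ?orbT.
move: h1 h2 va'; rewrite mulSnr !mulnDl mul1n e.
by move: (i * _) (D * _) (a0 * _) (w * _) va h3 => x y z u; lia.
Qed.

(** The mean distances travelled add up to [2 t / (T + 1)], which is [D + E - S] up to 1; rounding
    both of them down adds less than 2. *)
Lemma final_sum (D E S t T v u : nat) :
  let a0 := (v * 2) %/ T.+1 in let b0 := (u * 2) %/ T.+1 in
  S * T.+1 + 2 * t <= (D + E) * T.+1 -> (D + E) * T.+1 < S.+1 * T.+1 + 2 * t ->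
  v + u = t -> a0 < D -> b0 < E -> S <= (D - a0) + (E - b0) <= S + 2.
Proof.
move=> a0 b0 h1 h2 vut aD bE.
have va := leq_trunc_div (v * 2) T.+1; have va' := ltn_ceil (v * 2) (ltn0Sn T).
have ub := leq_trunc_div (u * 2) T.+1; have ub' := ltn_ceil (u * 2) (ltn0Sn T).
rewrite -/a0 in va va'; rewrite -/b0 in ub ub'.
have -> : D - a0 + (E - b0) = D + E - (a0 + b0) by lia.
have g1 : (S + (a0 + b0)) * T.+1 <= (D + E) * T.+1.
  by move: h1 va ub; rewrite !mulnDl; move: (S * _) (a0 * _) (b0 * _) (D * _) (E * _) => *; lia.
have g2 : (D + E) * T.+1 < (S + (a0 + b0) + 3) * T.+1.
  move: h2 va' ub'; rewrite !mulSnr !mulnDl.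
  by move: (S * _) (a0 * _) (b0 * _) (D * _) (E * _) => *; lia.
rewrite leq_mul2r /= in g1; rewrite ltn_mul2r /= in g2; lia.
Qed.

Lemma shifted_sum (S D E a b : nat) : S <= D + E <= S + 2 -> a <= 2 -> b <= 2 ->
  S <= (D + a) + (E + b) <= S + 10.
Proof. lia. Qed.

Local Open Scope ring_scope.

Section Travel.
Variable R : realType.

Lemma window_count_le (w D : nat) (c x : R) (i : nat) : 0 <= x ->
  ((D <= i < D + w)%N -> 2 ^+ i * c <= x) -> window_count w D c i <= x.
Proof. by rewrite /window_count => x0; case: ifP => // _; exact. Qed.

(* The constraints on the number [v] of successes are those which hold when the
   play stops, [2 * v / T.+1] being the mean distance travelled by the chips. *)
Definition window_bound (T D E t w : nat) (eta : R) (g : nat -> R) :=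
  forall v i : nat, (v * 2 <= D * T.+1 + 2)%N -> (2 * t <= v * 2 + E * T.+1)%N ->
    (D * T.+1 <= i * T.+1 + v * 2)%N -> (i * T.+1 + v * 2 <= (D + w + 3) * T.+1)%N ->
    eta <= iter v (avg (2 / T.+1%:R)) g i.

(** The bound 5/2 consists of the old imbalance 1, the rounding of the two positions, 1 in total,
    and the drift 1/2. Shifting one window by 2 repairs it. *)
Lemma shift_balance (z : R) : `|z| <= 5 / 2 ->
  exists a b : nat, [/\ (a <= 2)%N, (b <= 2)%N & `|z + b%:R - a%:R| <= 1].
Proof.
rewrite !ler_norml => /andP[z1 z2].
have [zl|zl] := ltP z (-1); first by exists 0%N, 2%N; split => //; rewrite ler_norml; lra.
have [zr|zr] := ltP 1 z; first by exists 2%N, 0%N; split => //; rewrite ler_norml; lra.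
by exists 0%N, 0%N; split => //; rewrite ler_norml; lra.
Qed.

(** Whatever Colorer does, the tilt changes by [th (v - u)] and the difference of the distances by
    about twice as much, so the windows stay balanced. If one side gets home early, its count at
    distance 0 is positive; otherwise new windows are read off near the mean positions. *)
Lemma travel (T D E t S w : nat) (gL gR : nat -> R) (eta rho rho' s : R)
    (L0 R0 : counts) :
  (1 < T)%N -> (0 < S)%N ->
  (S * T.+1 + 2 * t <= (D + E) * T.+1)%N ->
  ((D + E) * T.+1 < S.+1 * T.+1 + 2 * t)%N ->
  (4 * t <= T ^ 2)%N ->
  `|E%:R - D%:R - 2 * s| <= 1 ->
  window_bound T D E t w eta gL -> window_bound T E D t w eta gR ->
  0 <= rho -> 0 <= eta -> 0 < rho' ->
  rho' + t.+1%:R * expR (1 / 2 - S%:R / 10) <=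
    rho * eta * expR (- (2 * t%:R * T%:R^-1 ^+ 2)) ->
  (forall i, 2 ^+ i * (rho * expR s) * gL i - 1 <= (L0 i)%:R) ->
  (forall i, 2 ^+ i * (rho * expR (- s)) * gR i - 1 <= (R0 i)%:R) ->
  force (fun L R' => exists it : item R,
    [/\ valid S it, dens it = rho' & contains w it L R']) L0 R0.
Proof.
move=> T1 S0 tS1 tS2 tT hs wL wR rho0 eta0 rho'0 hrho hL hR.
pose th : R := T%:R^-1; pose loss : R := 2 * t%:R * th ^+ 2.
have T0 : 0 < T%:R :> R by rewrite ltr0n; lia.
have th0 : 0 < th by rewrite invr_gt0.
have thT : th * T%:R = 1 by rewrite mulVf // lt0r_neq0.
have th_half : 0 <= th <= 1 / 2.
  have : 2 <= T%:R :> R by rewrite (ler_nat _ 2).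
  by move=> T2; apply/andP; split; [exact: ltW | rewrite -(ler_pM2r T0) thT; lra].
pose q : R := 2 / T.+1%:R.
have q0 : 0 < q by rewrite divr_gt0.
have qT : q * T.+1%:R = 2 by rewrite mulfVK // pnatr_eq0.
have q2 : q = 2 * th - th * q.
  have : th * (q * (T%:R + 1)) = th * 2 by rewrite natr1 qT.
  by rewrite mulrDr mulr1 mulrDr mulrCA thT mulr1; lra.
have toR (a b : nat) : (a <= b)%N -> a%:R <= b%:R :> R by rewrite ler_nat.
have mulq (a b : R) : a * T.+1%:R <= b * T.+1%:R -> a <= b.
  by rewrite ler_pM2r.
have e2 : 2 = q * T.+1%:R by rewrite qT.
have St : S%:R + t%:R * q <= D%:R + E%:R.
  apply: mulq; have h := toR _ _ tS1; rewrite !(natrD, natrM) in h.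
  have tq : t%:R * q * T.+1%:R = 2 * t%:R by rewrite -mulrA qT mulrC.
  by rewrite !mulrDl tq; lra.
have tt : t%:R * th ^+ 2 <= 1 / 4.
  have : 4 * t%:R <= T%:R ^+ 2 :> R by rewrite -natrX -natrM ler_nat.
  have : th ^+ 2 * T%:R ^+ 2 = 1 by rewrite -exprMn thT expr1n.
  have : 0 < th ^+ 2 by rewrite exprn_gt0.
  move: (th ^+ 2) (T%:R ^+ 2) => x y x0 xy h.
  by have : x * (4 * t%:R) <= x * y by [rewrite ler_pM2l]; lra.
apply: (@uniform_play R T T1 D E t _ gL gR (rho * expR s) (rho * expR (- s))) => //.
move=> v u L R' vut vD uE stop pL pR.
(* The exponent is new tilt minus old tilt minus loss, the shape required by [cover_lower]. *)
have growL : expR (s + th * (v%:R - u%:R) - s - loss) <=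
    (1 + th) ^+ v * (1 - th) ^+ u.
  apply: le_trans (growth_bound v u th_half); rewrite ler_expR /loss.
  have : (v + u)%:R * th ^+ 2 <= t%:R * th ^+ 2.
    by rewrite ler_wpM2r ?sqr_ge0 // ler_nat.
  lra.
have growR : expR (- (s + th * (v%:R - u%:R)) - - s - loss) <=
    (1 + th) ^+ u * (1 - th) ^+ v.
  apply: le_trans (growth_bound u v th_half); rewrite ler_expR /loss addnC.
  have : (v + u)%:R * th ^+ 2 <= t%:R * th ^+ 2.
    by rewrite ler_wpM2r ?sqr_ge0 // ler_nat.
  lra.
pose s' := s + th * (v%:R - u%:R).
have vutR : v%:R + u%:R <= t%:R :> R by rewrite -natrD ler_nat.
(* The rates [2 * th] and [q] differ only by [th * q], which is of second order, and there are at
   most [T ^ 2 / 4] rounds. *)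
have drift : `|2 * (th * (v%:R - u%:R)) - q * (v%:R - u%:R)| <= 1 / 2.
  have -> : 2 * (th * (v%:R - u%:R)) - q * (v%:R - u%:R) = th * q * (v%:R - u%:R).
    by rewrite {1}q2; ring.
  have thq : 0 <= th * q <= 2 * th ^+ 2.
    by rewrite mulr_ge0 ?ltW //= expr2; nra.
  have v0 : 0 <= v%:R :> R by []. have u0 : 0 <= u%:R :> R by [].
  have : 0 <= th ^+ 2 by rewrite sqr_ge0.
  rewrite ler_norml; move: (th * q) (th ^+ 2) thq tt => x y /andP[x0 xy] ty y0.
  have a1 : x * v%:R <= 2 * (y * t%:R) by nra.
  have a2 : x * u%:R <= 2 * (y * t%:R) by nra.
  have a3 : 0 <= x * v%:R by rewrite mulr_ge0.
  have a4 : 0 <= x * u%:R by rewrite mulr_ge0.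
  by rewrite mulrBr; apply/andP; split; lra.
have S1 : 1 <= S%:R :> R by rewrite (ler_nat _ 1).
have dv : q * (v%:R - u%:R) = v%:R * q - u%:R * q by ring.
have vuq : v%:R * q + u%:R * q <= t%:R * q by rewrite -mulrDl ler_pM2r.
have mulq2 (a b : nat) : (a * T.+1 <= b * 2)%N -> a%:R <= b%:R * q.
  by move/toR; rewrite !natrM => h; apply: mulq; rewrite -mulrA qT.
have mulq3 (a b : nat) : (b * 2 <= a * T.+1)%N -> b%:R * q <= a%:R.
  by move/toR; rewrite !natrM => h; apply: mulq; rewrite -mulrA qT.
move: hs drift; rewrite dv !ler_norml => /andP[hs1 hs2] /andP[dr1 dr2].
have [Dv|vD'] := leqP (D * T.+1) (v * 2).
  have hg : eta <= iter v (avg q) gL 0.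
    by have [] := early_stop_window w tS1 T1 Dv vD; exact: wL.
  have Dq := mulq2 _ _ Dv.
  (* The right side has moved at most [D + E - S - v q], with [v q >= D], so balance forces
     [s' >= S / 2 - 3 / 4]. *)
  have size0 : expR (S%:R / 10 - 1 / 2) <= 2 ^+ 0 * expR s'.
    by rewrite expr0 [leRHS]mul1r ler_expR /s'; lra.
  apply: ForceGoal; rewrite -(ltr0n R).
  have := cover_lower rho0 eta0 hrho hg growL size0.
  move=> /le_trans/(_ (pL 0%N)) hL0; rewrite (lt_le_trans _ hL0) //.
  by rewrite expr0 mul1r mulr_gt0 ?expR_gt0.
have [Eu|uE'] := leqP (E * T.+1) (u * 2).
  have hg : eta <= iter u (avg q) gR 0.
    have tS1' : (S * T.+1 + 2 * t <= (E + D) * T.+1)%N by rewrite (addnC E).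
    by have [] := early_stop_window w tS1' T1 Eu uE; exact: wR.
  have Eq := mulq2 _ _ Eu.
  have size0 : expR (S%:R / 10 - 1 / 2) <= 2 ^+ 0 * expR (- s').
    by rewrite expr0 [leRHS]mul1r ler_expR /s'; lra.
  apply: ForceGoal; rewrite orbC -(ltr0n R).
  have := cover_lower rho0 eta0 hrho hg growR size0.
  move=> /le_trans/(_ (pR 0%N)) hR0; rewrite (lt_le_trans _ hR0) //.
  by rewrite expr0 mul1r mulr_gt0 ?expR_gt0.
have vut' : (v + u = t)%N.
  by case/or3P: stop => [/eqP//||]; rewrite leqNgt ?vD' ?uE'.
set a0 := (v * 2 %/ T.+1)%N; set b0 := (u * 2 %/ T.+1)%N.
have va := leq_trunc_div (v * 2) T.+1; have va' := ltn_ceil (v * 2) (ltn0Sn T).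
have ub := leq_trunc_div (u * 2) T.+1; have ub' := ltn_ceil (u * 2) (ltn0Sn T).
have aD : (a0 < D)%N by rewrite ltn_divLR.
have bE : (b0 < E)%N by rewrite ltn_divLR.
rewrite -/a0 in va va'; rewrite -/b0 in ub ub'.
have qa1 := mulq2 _ _ va; have qb1 := mulq2 _ _ ub.
have qa2 := mulq3 _ _ (ltnW va'); have qb2 := mulq3 _ _ (ltnW ub').
pose D0 := (D - a0)%N; pose E0 := (E - b0)%N.
have D0E : D0%:R = D%:R - a0%:R :> R by rewrite natrB // ltnW.
have E0E : E0%:R = E%:R - b0%:R :> R by rewrite natrB // ltnW.
rewrite -!(natr1 (R := R)) in qa2 qb2.
have [|a [b [a2 b2]]] := @shift_balance (E0%:R - D0%:R - 2 * s').
  by rewrite D0E E0E /s' ler_norml; apply/andP; split; lra.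
rewrite -addrA ler_norml => /andP[bal1 bal2].
have DES : (S <= D0 + E0 <= S + 2)%N := final_sum tS1 tS2 vut' aD bE.
have DES' := shifted_sum DES a2 b2; have /andP[SDE _] := DES'.
have SED : (S <= (E0 + b) + (D0 + a))%N by rewrite addnC.
apply: ForceDone; exists (Item (D0 + a) (E0 + b) rho' s'); split => //.
  split => //=; [by rewrite ltn_addr // subn_gt0 | by rewrite ltn_addr // subn_gt0 | ].
  by rewrite !natrD ler_norml; apply/andP; split; lra.
have D0a : (D0 + a)%:R = D0%:R + a%:R :> R by rewrite natrD.
have E0b : (E0 + b)%:R = E0%:R + b%:R :> R by rewrite natrD.
have tE : (2 * t <= u * 2 + D * T.+1)%N /\ (2 * t <= v * 2 + E * T.+1)%N.
  rewrite -vut' mulnDr !(mulnC 2).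
  by split; [rewrite addnC|]; rewrite leq_add2l; exact: ltnW.
split=> i; apply: window_count_le => //= range.
  have [w1 w2] := final_window a2 vD' range.
  have hg : eta <= iter v (avg q) gL i by apply: wL => //; exact: tE.2.
  apply: le_trans (pL i); apply: (cover_lower rho0 eta0 hrho hg growL).
  by apply: group_size SDE _ _; [case/andP: range | rewrite D0a E0b -/s'; lra].
have [w1 w2] := final_window b2 uE' range.
have hg : eta <= iter u (avg q) gR i by apply: wR => //; exact: tE.1.
apply: le_trans (pR i); apply: (cover_lower rho0 eta0 hrho hg growR).
by apply: group_size SED _ _; [case/andP: range | rewrite D0a E0b -/s'; lra].
Qed.

End Travel.

HB.instance Definition _ (R : realType) := gen_eqMixin (item R).

(** * Stages *)

Section Merge.
Variable R : realType.
Implicit Types (it : item R) (l : seq (item R)).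

Lemma window_bound_flat (T D E t w H len a0 : nat) (eta : R) : (1 < T)%N ->
  (0 < H)%N -> (D = a0 + H + 1)%N -> (2 * H + w + 4 <= len)%N ->
  eta <= 1 - (D.+1)%:R / H%:R ^+ 2 ->
  window_bound T D E t w eta (fun j => (a0 <= j < a0 + len)%N%:R).
Proof.
move=> T1 H0 DE Hlen he v i vD _ i1 i2.
have T0 : 0 < T.+1%:R :> R by [].
pose q : R := 2 / T.+1%:R.
have qT : q * T.+1%:R = 2 by rewrite mulfVK // pnatr_eq0.
have q01 : 0 <= q <= 1.
  apply/andP; split; first exact: divr_ge0.
  by rewrite -(ler_pM2r T0) qT mul1r (ler_nat _ 2) ltnS ltnW.
have toR (a b : nat) : (a <= b)%N -> a%:R <= b%:R :> R by rewrite ler_nat.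
have H0R : 0 < H%:R :> R by rewrite ltr0n.
have vq : v%:R * q <= D.+1%:R.
  rewrite -(ler_pM2r T0) -mulrA qT -natrM -natrM ler_nat.
  by apply: leq_trans vD _; rewrite mulSn addnC leq_add2r ltnS ltnW.
have m1 : D%:R <= i%:R + v%:R * q.
  rewrite -(ler_pM2r T0) mulrDl -mulrA qT.
  by have := toR _ _ i1; rewrite natrD !natrM.
have m2 : i%:R + v%:R * q <= D%:R + w%:R + 3.
  rewrite -(ler_pM2r T0) mulrDl -mulrA qT.
  by have := toR _ _ i2; rewrite natrD !natrM !natrD.
apply: (le_trans _ (@iter_avg_window R q (fun j => a0 <= j < a0 + len)%N
  v H%:R i q01 H0R _)); last first.
  move=> j; rewrite ltr_norml => /andP[j1 j2].
  have DR : D%:R = a0%:R + H%:R + 1 :> R by rewrite DE !natrD.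
  have lenR : 2 * H%:R + w%:R + 4 <= len%:R :> R.
    by rewrite -natrM -!natrD ler_nat.
  apply/andP; split; first by rewrite -(ler_nat R); lra.
  by rewrite -(ltr_nat R) natrD; lra.
apply: le_trans he _; rewrite lerB // ler_pM2r ?invr_gt0 ?exprn_gt0 //.
Qed.

Definition key it := (lpos it, rpos it).

Lemma big_by_key l (ts : seq (nat * nat)) (F : item R -> R) : uniq ts ->
  {in l, forall it, key it \in ts} ->
  \sum_(it <- l) F it = \sum_(d <- ts) \sum_(it <- l | key it == d) F it.
Proof.
move=> uts kts; rewrite (exchange_big_dep xpredT) //= !big_seq.
apply: eq_bigr => it itl; rewrite -big_filter.
rewrite (eq_filter (a2 := pred1 (key it))) => [|d]; last exact: eq_sym.
by rewrite filter_pred1_uniq ?kts // big_seq1.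
Qed.

Section Key.
Variables (l : seq (item R)) (d : nat * nat).

Let Lam := \sum_(it <- l | key it == d) dens it * expR (tilt it).
Let Mu := \sum_(it <- l | key it == d) dens it * expR (- tilt it).
(** With this tilt [Lam * expR (- s) = Mu * expR s], so the merged density is the geometric mean of
    [Lam] and [Mu]. *)
Let s := ln (Lam / Mu) / 2.

Definition merged := Item d.1 d.2 (Lam * expR (- s)) s.

Hypothesis dl : d \in map key l.
Variable S : nat.
Hypothesis lS : {in l, forall it, valid S it}.

Let sum_gt0 (F : item R -> R) : {in l, forall it, 0 < F it} ->
  0 < \sum_(it <- l | key it == d) F it.
Proof.
move=> F0; have /mapP[it itl dE] := dl.
rewrite big_seq_cond (big_rem it) //= itl dE eqxx /=.
rewrite ltr_pwDl ?F0 // sumr_ge0 // => jt /andP[jl _].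
exact/ltW/F0.
Qed.

(** The merged item stays balanced because [Lam / Mu] is a weighted mean of the numbers
    [expR (2 * tilt it)]. *)
Lemma merged_spec : [/\ valid S merged,
  dens merged * expR (tilt merged) = Lam,
  dens merged * expR (- tilt merged) = Mu &
  \sum_(it <- l | key it == d) dens it <= dens merged].
Proof.
have dp it : it \in l -> 0 < dens it by case/lS.
have Lam0 : 0 < Lam by apply: sum_gt0 => it /dp ?; rewrite mulr_gt0 ?expR_gt0.
have Mu0 : 0 < Mu by apply: sum_gt0 => it /dp ?; rewrite mulr_gt0 ?expR_gt0.
have e2 : expR (2 * s) = Lam / Mu.
  by rewrite /s mulrC divfK ?pnatr_eq0 // lnK // posrE divr_gt0.
have LamE : Lam * expR (- s) * expR s = Lam.
  by rewrite -mulrA -expRD addNr expR0 mulr1.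
have MuE : Lam * expR (- s) * expR (- s) = Mu.
  rewrite -mulrA -expRD (_ : - s - s = - (2 * s)); last by ring.
  by rewrite expRN e2 invf_div mulrCA mulfV ?mulr1 // lt0r_neq0.
have inl it : it \in l -> key it == d ->
    `|d.2%:R - d.1%:R - 2 * tilt it| <= 1 by move=> /lS[_ _ _ _ h] /eqP <-.
split=> //.
- have /mapP[it itl dE] := dl; have [h1 h2 h3 _ _] := lS itl.
  split; rewrite /= ?dE //; first by rewrite mulr_gt0 ?expR_gt0.
  rewrite -dE ler_norml; apply/andP; split.
    have : expR (2 * s) <= expR (d.2%:R - d.1%:R + 1).
      rewrite e2 ler_pdivrMr // mulr_sumr /Lam big_seq_cond [leRHS]big_seq_cond.
      apply: ler_sum => jt /andP[jl /(inl _ jl)]; rewrite ler_norml => /andP[j1 j2].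
      rewrite mulrCA ler_pM2l ?dp // -expRD ler_expR; lra.
    rewrite ler_expR; lra.
  have : expR (d.2%:R - d.1%:R - 1) <= expR (2 * s).
    rewrite e2 ler_pdivlMr // mulr_sumr /Lam big_seq_cond [leRHS]big_seq_cond.
    apply: ler_sum => jt /andP[jl /(inl _ jl)]; rewrite ler_norml => /andP[j1 j2].
    rewrite mulrCA ler_pM2l ?dp // -expRD ler_expR; lra.
  rewrite ler_expR; lra.
- (* the cosh inequality [2 <= expR y + expR (- y)] with [y = tilt it - s] *)
  have e : 2 * (Lam * expR (- s)) = Lam * expR (- s) + Mu * expR s.
    have -> : Mu * expR s = Lam * expR (- s).
      by rewrite -MuE -!mulrA -!expRD; congr (_ * expR _); ring.
    by ring.
  rewrite -(ler_pM2l (ltr0n R 2)) /= e mulr_sumr !mulr_suml -big_split /=.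
  rewrite big_seq_cond [leRHS]big_seq_cond; apply: ler_sum => it /andP[/dp d0 _].
  rewrite -!mulrA -!expRD -mulrDr mulrC ler_pM2l //.
  have := expR_ge1Dx (tilt it - s); have := expR_ge1Dx (- tilt it + s); lra.
Qed.

End Key.

Definition lsum w l i := \sum_(it <- l) lcover w it i.
Definition rsum w l i := \sum_(it <- l) rcover w it i.

(** After merging there is at most one item per pair of positions, and both positions are at most
    [S + 10]. Hence at most [(S + 11) ^ 2] items are dropped, each of density below [thr]. *)
Lemma merge_drop S w l thr : 0 < thr -> {in l, forall it, valid S it} ->
  exists l', [/\ {in l', forall it, valid S it /\ thr <= dens it},
    \sum_(it <- l) dens it - (S + 11)%:R ^+ 2 * thr <= \sum_(it <- l') dens it &
    forall i, lsum w l' i <= lsum w l i /\ rsum w l' i <= rsum w l i].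
Proof.
move=> thr0 lS; pose ts := undup (map key l).
have uts : uniq ts := undup_uniq _.
have kts : {in l, forall it, key it \in ts}.
  by move=> it itl; rewrite mem_undup map_f.
have tsl d : d \in ts -> d \in map key l by rewrite mem_undup.
pose big_enough d := thr <= dens (merged l d).
exists [seq merged l d | d <- ts & big_enough d]; split.
- move=> it /mapP[d]; rewrite mem_filter => /andP[bd /tsl dl] ->.
  by have [] := merged_spec dl lS.
- rewrite big_map big_filter (big_by_key _ uts kts).
  have size_ts : (size ts <= (S + 11) ^ 2)%N.
    rewrite -mulnn -[leqRHS](_ : size [seq (a, b) | a <- iota 0 (S + 11), b <- iota 0 (S + 11)] = _); last first.
      by rewrite size_allpairs !size_iota.
    apply: uniq_leq_size => // d /tsl/mapP[it itl ->].
    have [_ _ /andP[_ h] _ _] := lS _ itl.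
    by apply: allpairs_f; rewrite mem_iota /=; lia.
  rewrite lerBlDl.
  apply: (@le_trans _ _ (\sum_(d <- ts) thr + \sum_(d <- ts | big_enough d) dens (merged l d))).
    rewrite [X in _ + X]big_mkcond -big_split /= big_seq [leRHS]big_seq.
    apply: ler_sum => d /tsl dl; have [_ _ _ h] := merged_spec dl lS.
    case: ifPn => [_|]; first by apply: le_trans h _; rewrite lerDr ltW.
    by rewrite /big_enough -ltNge addr0 => /ltW; exact: le_trans.
  rewrite lerD2r big_const_seq iter_addr_0 -[leLHS]mulr_natl ler_pM2r // -natrX ler_nat.
  by rewrite count_predT.
- move=> i; have cover_ge0 it D y : 0 < dens it -> 0 <= window_count w D (dens it * expR y) i.
    by move=> d0; rewrite window_count_ge0 // mulr_ge0 ?expR_ge0 // ltW.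
  split; rewrite /lsum /rsum big_map big_filter (big_by_key _ uts kts).
    rewrite big_mkcond /= big_seq [leRHS]big_seq; apply: ler_sum => d /tsl dl.
    have [[_ _ _ d0 _] h _ _] := merged_spec dl lS.
    apply: (@le_trans _ _ (lcover w (merged l d) i)).
      by case: ifP => // _; exact: cover_ge0.
    rewrite /lcover h /window_count; case: ifP => range /=.
      rewrite mulr_sumr ler_sum // => it /eqP; rewrite /key => kd.
      by rewrite -kd /= in range; rewrite range.
    by rewrite big1 // => it /eqP kd; rewrite -kd /= in range; rewrite range.
  rewrite big_mkcond /= big_seq [leRHS]big_seq; apply: ler_sum => d /tsl dl.
  have [[_ _ _ d0 _] _ h _] := merged_spec dl lS.
  apply: (@le_trans _ _ (rcover w (merged l d) i)).
    by case: ifP => // _; exact: cover_ge0.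
  rewrite /rcover h /window_count; case: ifP => range /=.
    rewrite mulr_sumr ler_sum // => it /eqP; rewrite /key => kd.
    by rewrite -kd /= in range; rewrite range.
  by rewrite big1 // => it /eqP kd; rewrite -kd /= in range; rewrite range.
Qed.

End Merge.

Local Open Scope nat_scope.

(** The mean distances of the two sides add up to [2 t / (T + 1)]; this [t] brings the sum of the
    positions from [X] down to [S]. *)
Lemma travel_time (X S T : nat) : 0 < T -> S <= X ->
  let t := ((X - S) * T.+1) %/ 2 in
  [/\ S * T.+1 + 2 * t <= X * T.+1, X * T.+1 < S.+1 * T.+1 + 2 * t &
      2 * t <= X * T.+1].
Proof.
move=> T0 SX t.
have h1 : t * 2 <= (X - S) * T.+1 := leq_trunc_div _ _.
have h2 : (X - S) * T.+1 < t.+1 * 2 := ltn_ceil _ (ltn0Sn 1).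
have e : X * T.+1 = (X - S) * T.+1 + S * T.+1 by rewrite -mulnDl subnK.
rewrite [S.+1 * _]mulSn e; move: t ((X - S) * _) (S * _) h1 h2 => t x y h1 h2; split; lia.
Qed.

Lemma piece_position (l r x H w M S S' : nat) : S' <= S -> S <= l + r <= S + 10 ->
  x <= w -> S + 10 + 2 * (w + H + 1) <= M ->
  [/\ S' <= (l + x + H + 1) + (r + x + H + 1),
      (l + x + H + 1) + (r + x + H + 1) <= M,
      (l + x + H + 1).+1 <= M.+1 & (r + x + H + 1).+1 <= M.+1].
Proof. by move=> *; split; lia. Qed.

Local Open Scope ring_scope.

(** * One stage: cutting the windows and playing the pieces *)

Section Stage.
Variable R : realType.
Implicit Types (it : item R) (l : seq (item R)).

Definition stage (S w : nat) (c : R) (L R' : counts) := exists l,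
  [/\ {in l, forall it, valid S it}, c <= \sum_(it <- l) dens it,
      forall i, lsum w l i <= (L i)%:R & forall i, rsum w l i <= (R' i)%:R].

Lemma upclosed_stage S w c : upclosed (stage S w c).
Proof.
move=> L M L' M' LL' MM' [l [lS cl lL lM]]; exists l; split=> // i.
  by apply: le_trans (lL i) _; rewrite ler_nat.
by apply: le_trans (lM i) _; rewrite ler_nat.
Qed.

(** The pieces are played in turn: first one while the others lie idle, then the others while its
    outcome lies idle. *)
Lemma force_stage (S w : nat) (J : eqType) (r : seq J) (PL PR : J -> counts)
    (d : J -> R) :
  {in r, forall j, force (fun L R' => exists it,
    [/\ valid S it, dens it = d j & contains w it L R']) (PL j) (PR j)} ->
  force (stage S w (\sum_(j <- r) d j))
        (fun i => \sum_(j <- r) PL j i)%N (fun i => \sum_(j <- r) PR j i)%N.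
Proof.
elim: r => [|j r IH] hr.
  apply: ForceDone; exists [::]; rewrite !big_nil.
  by split=> [it||i|i]; rewrite ?in_nil ?/lsum ?/rsum ?big_nil.
have /IH : {in r, forall j, force (fun L R' => exists it,
    [/\ valid S it, dens it = d j & contains w it L R']) (PL j) (PR j)}.
  by move=> j' j'r; apply: hr; rewrite inE j'r orbT.
set L1 : counts := (fun i => _)%N; set R1 : counts := (fun i => _)%N => IHr.
have -> : (fun i => \sum_(j0 <- j :: r) PL j0 i)%N = addc (PL j) L1.
  by apply/funext => i; rewrite /addc big_cons.
have -> : (fun i => \sum_(j0 <- j :: r) PR j0 i)%N = addc (PR j) R1.
  by apply/funext => i; rewrite /addc big_cons.
apply: (force_frame (upclosed_stage (c := _))); last exact: hr (mem_head _ _).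
move=> L M [it [vit dit [itL itM]]].
have addcC A B : addc A B = addc B A by apply/funext => i; rewrite /addc addnC.
rewrite (addcC L) (addcC M).
apply: (force_frame (upclosed_stage (c := _))) IHr => L' M' [l [lS cl lL lM]].
apply: ForceDone; exists (it :: l); split.
- by move=> it'; rewrite inE => /predU1P[->|/lS].
- by rewrite !big_cons dit lerD2l.
- by move=> i; rewrite /lsum big_cons /addc natrD addrC; apply: lerD; [exact: lL | exact: itL].
- by move=> i; rewrite /rsum big_cons /addc natrD addrC; apply: lerD; [exact: lM | exact: itM].
Qed.

Definition piece (len D : nat) (c : R) (q i : nat) : nat :=
  if (D + q * len <= i < D + q * len + len)%N then Num.truncn (2 ^+ i * c) else 0%N.

Lemma sum_piece (len D w n : nat) (c : R) i : 0 <= c -> (n * len <= w)%N ->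
  (\sum_(q <- iota 0 n) piece len D c q i)%N%:R <= window_count w D c i.
Proof.
move=> c0 nw; have x0 : 0 <= 2 ^+ i * c by rewrite mulr_ge0 ?exprn_ge0.
apply: (@le_trans _ _ (window_count (n * len) D c i)); last first.
  rewrite /window_count; case: ifP => [/andP[-> h]|_].
    by rewrite (leq_trans h) // leq_add2l.
  by case: ifP.
elim: n {nw} => [|n IH].
  by rewrite big_nil /window_count mul0n addn0; case: ifP => // /andP[]; lia.
rewrite -[n.+1]addn1 iotaD big_cat big_seq1 natrD add0n mulnDl mul1n.
apply: le_trans (lerD IH (lexx _)) _; rewrite /window_count /piece.
have tr : (Num.truncn (2 ^+ i * c))%:R <= 2 ^+ i * c by rewrite truncn_le.
move: (n * len)%N => y; rewrite addnA.
have [h1|h1] := leqP D i; last first.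
  have /negPf -> /= : ~~ (D + y <= i)%N by rewrite -ltnNge; lia.
  by rewrite addr0.
have [h2|h2] /= := ltnP i (D + y).
  by rewrite addr0; case: ifP => //; lia.
by rewrite add0r; case: ifP.
Qed.

Lemma piece_lower (len D : nat) (c : R) (q i : nat) : 0 <= c ->
  2 ^+ i * c * (D + q * len <= i < D + q * len + len)%N%:R - 1 <=
    (piece len D c q i)%:R.
Proof.
move=> c0; rewrite /piece; case: ifP => _; last by rewrite mulr0 sub0r lerN10.
by rewrite mulr1 lerBlDr natr1 ltW // truncnS_gt.
Qed.

(** Windows are merged and cut into [n] pieces. Every piece inherits the full density of its window,
    of which the play keeps the fraction [kappa], so the total density gains the factor [n * kappa].
    [M] bounds the sum of the positions and [B] twice the number of rounds. *)
Lemma stage_step (T H w w' len S S' n M B : nat) (c thr kappa eta : R)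
    (L0 R0 : counts) :
  (1 < T)%N -> (0 < H)%N -> (0 < S')%N -> (S' <= S)%N ->
  (2 * H + w' + 4 <= len)%N -> (n * len <= w)%N ->
  (S + 10 + 2 * (w + H + 1) <= M)%N -> (M * T.+1 <= B)%N -> (2 * B <= T ^ 2)%N ->
  0 <= eta -> eta <= 1 - M.+1%:R / H%:R ^+ 2 -> 0 < thr -> 0 < kappa ->
  kappa * thr + B.+1%:R * expR (1 / 2 - S'%:R / 10) <=
    thr * eta * expR (- (2 * B%:R * T%:R^-1 ^+ 2)) ->
  stage S w c L0 R0 ->
  force (stage S' w' (n%:R * kappa * (c - (S + 11)%:R ^+ 2 * thr))) L0 R0.
Proof.
move=> T1 H0 S'0 SS' hlen nw SM MB BT eta0 etaH thr0 kap0 hkap [l0 [l0S cl0 l0L l0R]].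
have [l [lS cl lL]] := merge_drop w thr0 l0S.
pose r := [seq (it, q) | it <- l, q <- iota 0 n].
pose PL (j : item R * nat) :=
  piece len (lpos j.1) (dens j.1 * expR (tilt j.1)) j.2.
pose PR (j : item R * nat) :=
  piece len (rpos j.1) (dens j.1 * expR (- tilt j.1)) j.2.
have dpos it : it \in l -> 0 < dens it by case/lS => -[].
have hL : lec (fun i => \sum_(j <- r) PL j i)%N L0.
  move=> i; rewrite -(ler_nat R); apply: le_trans (l0L i).
  apply: le_trans (lL i).1; rewrite /r big_allpairs natr_sum /lsum.
  rewrite big_seq [leRHS]big_seq; apply: ler_sum => it /dpos d0.
  have c0 : 0 <= dens it * expR (tilt it) by rewrite mulr_ge0 ?expR_ge0 // ltW.
  exact: (@sum_piece len (lpos it) w n _ i c0 nw).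
have hR : lec (fun i => \sum_(j <- r) PR j i)%N R0.
  move=> i; rewrite -(ler_nat R); apply: le_trans (l0R i).
  apply: le_trans (lL i).2; rewrite /r big_allpairs natr_sum /rsum.
  rewrite big_seq [leRHS]big_seq; apply: ler_sum => it /dpos d0.
  have c0 : 0 <= dens it * expR (- tilt it) by rewrite mulr_ge0 ?expR_ge0 // ltW.
  exact: (@sum_piece len (rpos it) w n _ i c0 nw).
apply: (force_mono (upclosed_stage (c := _)) hL hR).
have weaken L M' c1 c2 : c1 <= c2 -> stage S' w' c2 L M' -> stage S' w' c1 L M'.
  by move=> c12 [l' [h1 h2 h3 h4]]; exists l'; split=> //; exact: le_trans h2.
apply: (@force_bind (stage S' w' (\sum_(j <- r) dens j.1 * kappa))) (upclosed_stage (c := _)) _ _.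
  move=> L M' h; apply: ForceDone; apply: weaken h.
  rewrite /r big_allpairs /=.
  under eq_bigr do rewrite big_const_seq iter_addr_0 count_predT size_iota.
  under eq_bigr do rewrite -mulr_natl mulrCA.
  rewrite -mulr_suml [leRHS]mulrC; apply: ler_wpM2l.
    by rewrite mulr_ge0 // ltW.
  by apply: le_trans cl; rewrite lerB.
apply: force_stage => -[it q] /allpairsP[[it' q'] /= [itl]].
rewrite mem_iota add0n => /andP[_ qn] [-> ->] {it q}; rewrite /PL /PR /= .
have [[l1 r1 sum_lr d0 bal] dthr] := lS _ itl.
set D := (lpos it' + q' * len + H + 1)%N; set E := (rpos it' + q' * len + H + 1)%N.
have qlen : (q' * len <= w)%N by apply: leq_trans nw; rewrite leq_mul2r ltnW ?orbT.
have [S'X XM DM EM] := piece_position SS' sum_lr qlen SM; rewrite -/D -/E in S'X XM DM EM.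
have [] := travel_time (ltnW T1) S'X; set t := (_ %/ 2)%N => t1 t2 t3.
have t4 : (2 * t <= B)%N.
  by apply: leq_trans t3 _; apply: leq_trans MB; rewrite leq_mul2r XM orbT.
have tB : (t <= B)%N by apply: leq_trans t4; exact: leq_pmull.
apply: (@travel R T D E t S' w'
  (fun j => (lpos it' + q' * len <= j < lpos it' + q' * len + len)%N%:R)
  (fun j => (rpos it' + q' * len <= j < rpos it' + q' * len + len)%N%:R)
  eta (dens it') (dens it' * kappa) (tilt it')) => //.
- by apply: leq_trans BT; rewrite -[4%N]/(2 * 2)%N -mulnA leq_pmul2l.
- by rewrite /D /E !natrD; move: bal; rewrite !ler_norml; lra.
- apply: (@window_bound_flat _ _ _ _ _ _ H) => //.
  apply: le_trans etaH _; rewrite lerB // ler_wpM2r ?invr_ge0 ?exprn_ge0 //.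
  by rewrite ler_nat.
- apply: (@window_bound_flat _ _ _ _ _ _ H) => //.
  apply: le_trans etaH _; rewrite lerB // ler_wpM2r ?invr_ge0 ?exprn_ge0 //.
  by rewrite ler_nat.
- exact: ltW.
- by rewrite mulr_gt0.
- set e := expR (1 / 2 - _) in hkap *; have e0 : 0 < e by exact: expR_gt0.
  have tB' : t.+1%:R * e <= B.+1%:R * e by rewrite ler_pM2r // ler_nat.
  have ex : expR (- (2 * B%:R * T%:R^-1 ^+ 2)) <=
            expR (- (2 * t%:R * T%:R^-1 ^+ 2)) :> R.
    by rewrite ler_expR lerN2 ler_wpM2r ?sqr_ge0 // ler_wpM2l // ler_nat.
  have B0 : 0 <= B.+1%:R * e by rewrite mulr_ge0 // ltW.
  set x := expR (- (2 * B%:R * _)) in ex hkap *.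
  (* The assumption at density [thr] forces [kappa <= eta * x], so it carries over to all larger
     densities. *)
  have k2 : 0 <= eta * x - kappa.
    rewrite -(pmulr_rge0 _ thr0); move: hkap; rewrite mulrBr mulrA (mulrC thr kappa).
    by lra.
  apply: le_trans (lerD (lexx _) tB') _.
  apply: (@le_trans _ _ (dens it' * eta * x)); last first.
    by rewrite ler_wpM2l // mulr_ge0 // ltW.
  have : thr * (eta * x - kappa) <= dens it' * (eta * x - kappa).
    by rewrite ler_wpM2r.
  by move: hkap; rewrite !mulrBr !mulrA (mulrC kappa thr); lra.
- by move=> i; apply: piece_lower; rewrite mulr_ge0 ?expR_ge0 // ltW.
- by move=> i; apply: piece_lower; rewrite mulr_ge0 ?expR_ge0 // ltW.
Qed.

End Stage.

(** * Passing from scale [2 y] to scale [y] *)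

Local Open Scope nat_scope.

(** At scale [x] the distances add up to about [2 x ^ 6] and spread by the order of [x ^ 3], far
    less than this width, which is nearly [x ^ 5]. The term 100 pays for the margins lost in
    cutting. *)
Definition width x := x ^ 4 * (x - 100).

Lemma halving_margins y : 1000 <= y ->
  2 * (20 * y ^ 4) + width y + 4 <= y ^ 4 * (y - 50).
Proof.
move=> y1; have z0 : 0 < y ^ 4 by rewrite expn_gt0; lia.
have -> : y - 50 = (y - 100) + 50 by lia.
by rewrite mulnDr /width; move: (y ^ 4) z0 (_ * (y - 100)) => z z0 w; lia.
Qed.

Lemma halving_cut y : 32 * (y ^ 4 * (y - 50)) <= width (2 * y).
Proof.
rewrite /width expnMn; have -> : 2 * y - 100 = 2 * (y - 50) by lia.
by move: (y ^ 4) => z; lia.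
Qed.

Lemma halving_extent y : 1000 <= y ->
  2 * (2 * y) ^ 6 + 10 + 2 * (width (2 * y) + 20 * y ^ 4 + 1) <= 200 * y ^ 6.
Proof.
move=> y1; have z0 : 0 < y ^ 4 by rewrite expn_gt0; lia.
have h1 : y ^ 4 <= y ^ 6 by rewrite leq_exp2l //; apply: leq_trans y1.
have h2 : width (2 * y) <= y ^ 6.
  rewrite /width expnMn (_ : 6 = 4 + 2) // expnD -mulnA [_ * (y ^ 4 * _)]mulnCA.
  rewrite leq_mul2l; apply/orP; right; rewrite -mulnn.
  apply: (@leq_trans (2 ^ 4 * (2 * y))); first by rewrite leq_mul2l leq_subr orbT.
  by rewrite mulnA leq_mul2r; apply/orP; right; apply: leq_trans y1.
rewrite expnMn; move: (y ^ 4) (y ^ 6) (width _) z0 h1 h2 => z u w; lia.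
Qed.

Lemma halving_duration y : 1000 <= y ->
  200 * y ^ 6 * (y ^ 8).+1 <= 201 * y ^ 14 /\ 2 * (201 * y ^ 14) <= (y ^ 8) ^ 2.
Proof.
move=> y1; have z0 : 0 < y ^ 6 by rewrite expn_gt0; lia.
have h : y ^ 6 * 1000 <= y ^ 14.
  rewrite (expnD y 6 8) leq_mul2l; apply/orP; right.
  by apply: (leq_trans y1); rewrite -{1}[y]expn1 leq_exp2l //; exact: leq_trans y1.
have e : y ^ 6 * y ^ 8 = y ^ 14 by rewrite -expnD.
split; first by rewrite mulnS -mulnA e; move: (y ^ 6) (y ^ 14) z0 h => *; lia.
rewrite -expnM (_ : 8 * 2 = 14 + 2) // expnD mulnA mulnC leq_mul2l.
apply/orP; right; rewrite -mulnn; apply: leq_trans (leq_pmulr y _).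
  by apply: leq_trans y1.
by apply: leq_trans y1.
Qed.

Local Open Scope ring_scope.

Section Halving.
Variable R : realType.

(** The term of degree 6 of the exponential series contains [y ^ 36], and [y ^ 3 >= 10 ^ 18]
    outweighs the constants. *)
Lemma exp_beats_power (y : R) : 10 ^+ 6 <= y ->
  5 * 10 ^+ 8 * y ^+ 33 <= expR (2 * y ^+ 6 / 10).
Proof.
move=> y1; have y0 : 0 <= y by apply: le_trans y1; rewrite exprn_ge0.
apply: (@le_trans _ _ (1 + (2 * y ^+ 6 / 10) ^+ 6 / 6`!%:R)); last first.
  by apply: expR_ge1Dxn; rewrite !mulr_ge0 ?exprn_ge0 // invr_ge0.
have -> : 6`!%:R = 720 :> R by [].
have -> : (2 * y ^+ 6 / 10) ^+ 6 / 720 = y ^+ 33 * (y ^+ 3 * ((2 / 10) ^+ 6 / 720)).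
  by field.
have y3 : (10 ^+ 6) ^+ 3 <= y ^+ 3 by rewrite lerXn2r ?nnegrE ?exprn_ge0.
have y33 : 0 <= y ^+ 33 by rewrite exprn_ge0.
rewrite mulrC; apply: (@le_trans _ _ (y ^+ 33 * (y ^+ 3 * ((2 / 10) ^+ 6 / 720)))).
  by apply: ler_wpM2l => //; move: (y ^+ 3) y3 => z; lra.
by rewrite lerDr.
Qed.

(* The factor [2 - 100 / y] leaves room for the losses of all later stages. *)
Definition level (K y : R) : R := K * (2 - 100 / y) / y ^+ 5.

Lemma stage_weaken S w (c c' : R) L R' : c <= c' -> stage S w c' L R' -> stage S w c L R'.
Proof. by move=> cc' [l [h1 h2 h3 h4]]; exists l; split=> //; exact: le_trans h2. Qed.

(** Cutting into 32 pieces compensates for [y ^ 5] becoming 32 times smaller. The relative losses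
    are of order [1 / y] and are paid for by the decrease of [2 - 50 / y] to [2 - 100 / y]. *)
Lemma halving (K : R) (y : nat) L0 R0 : 1 <= K -> 10 ^+ 6 <= y%:R :> R ->
  stage (2 * (2 * y) ^ 6) (width (2 * y)) (level K (2 * y)%N%:R) L0 R0 ->
  force (stage (2 * y ^ 6) (width y) (level K y%:R)) L0 R0.
Proof.
move=> K1 yR st.
have y1000 : (1000 <= y)%N.
  rewrite -(ler_nat R); apply: le_trans yR.
  by rewrite (_ : 1000%N%:R = 10 ^+ 3) ?ler_eXn2l //; lra.
have y0 : (0 < y)%N by apply: leq_trans y1000.
have y1 : (1 < y)%N by apply: leq_trans y1000.
set Y : R := y%:R in yR *.
have Y0 : 0 < Y by rewrite ltr0n.
pose i : R := Y^-1; have i0 : 0 < i by rewrite invr_gt0.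
have iY : i * Y = 1 by rewrite mulVf // lt0r_neq0.
have i_small : i <= (10 ^+ 6)^-1 by rewrite lef_pV2 ?posrE ?exprn_gt0.
have [dur1 dur2] := halving_duration y1000.
(* Small enough that dropping, at about [y ^ 12] positions, costs only a fraction [1 / y] of the
   level, and far above the exponentially small rounding error. *)
pose thr : R := i ^+ 18 / 10 ^+ 6.
have thr0 : 0 < thr by rewrite divr_gt0 ?exprn_gt0.
have i2 : 0 <= i ^+ 2 <= i / 10 ^+ 6.
  by rewrite sqr_ge0 /= expr2 ler_pM2l.
have p6 : (10 ^+ 6)^-1 <= 1 / 1000 :> R by rewrite div1r lef_pV2 ?posrE ?exprn_gt0 //; lra.
(* In [kappa = 1 - 3 * i], one [i] pays for rounding and another for the growth loss [402 * i ^ 2];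
   the last one covers the Chebyshev loss [i ^ 2]. *)
apply: (@force_bind _ _ _ _ (upclosed_stage (c := _)) _
  (@stage_step R (y ^ 8) (20 * y ^ 4) (width (2 * y)) (width y) (y ^ 4 * (y - 50))
     (2 * (2 * y) ^ 6) (2 * y ^ 6) 32 (200 * y ^ 6) (201 * y ^ 14)
     (level K (2 * y)%N%:R) thr (1 - 3 * i) (1 - i ^+ 2) L0 R0 _ _ _ _ _ _ _ _ _ _ _ _ _ _ st)).
- move=> L R' h; apply: ForceDone; apply: stage_weaken h.
  have -> : level K Y = i ^+ 5 * (K * (2 - 100 * i)) by rewrite /level exprVn /i; ring.
  have -> : level K (2 * y)%N%:R = i ^+ 5 * (K * (2 - 50 * i) / 32).
    by rewrite /level natrM -/Y /i exprVn; field; rewrite lt0r_neq0.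
  have S2 : (2 * (2 * y) ^ 6 + 11)%N%:R ^+ 2 * thr <= i ^+ 5 * (i / 50).
    have Yi : Y ^+ 12 * i ^+ 12 = 1 by rewrite -exprMn mulrC iY expr1n.
    have h129 : (2 * (2 * y) ^ 6 + 11)%N%:R <= 129 * Y ^+ 6.
      have Y6 : 11 <= Y ^+ 6.
        rewrite -natrX (ler_nat _ 11); apply: leq_trans (leq_trans _ y1000) _ => //.
        by rewrite -{1}[y]expn1 leq_exp2l.
      by rewrite natrD natrM natrX natrM -/Y exprMn; lra.
    apply: (@le_trans _ _ ((129 * Y ^+ 6) ^+ 2 * thr)).
      by rewrite ler_pM2r // lerXn2r ?nnegrE // mulr_ge0 // exprn_ge0 // ltW.
    have -> : (129 * Y ^+ 6) ^+ 2 * thr = (Y ^+ 12 * i ^+ 12) * (129 ^+ 2 * i ^+ 6 / 10 ^+ 6).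
      by rewrite /thr; ring.
    rewrite Yi mul1r; have -> : i ^+ 5 * (i / 50) = i ^+ 6 / 50 by ring.
    have : 0 < i ^+ 6 by rewrite exprn_gt0.
    by move: (i ^+ 6) => z; lra.
  have i5 : 0 < i ^+ 5 by rewrite exprn_gt0.
  have k0 : 0 <= 32 * (1 - 3 * i) by lra.
  apply: (@le_trans _ _ (32 * (1 - 3 * i) *
    (i ^+ 5 * (K * (2 - 50 * i) / 32) - i ^+ 5 * (i / 50)))); last first.
    by apply: ler_wpM2l => //; rewrite lerB.
  have -> : 32 * (1 - 3 * i) * (i ^+ 5 * (K * (2 - 50 * i) / 32) - i ^+ 5 * (i / 50)) =
    i ^+ 5 * ((1 - 3 * i) * (K * (2 - 50 * i) - 64 / 100 * i)) by field.
  rewrite ler_pM2l //.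
  apply: (@le_trans _ _ ((1 - 3 * i) * (K * (2 - 51 * i)))); last first.
    apply: ler_wpM2l; first lra.
    have : i <= K * i by rewrite ler_peMl // ltW.
    have -> : K * (2 - 51 * i) = 2 * K - 51 * (K * i) by ring.
    have -> : K * (2 - 50 * i) = 2 * K - 50 * (K * i) by ring.
    by move: (K * i) => z; lra.
  rewrite mulrCA ler_pM2l; last lra.
  have -> : (1 - 3 * i) * (2 - 51 * i) = 2 - 57 * i + 153 * i ^+ 2 by ring.
  by lra.
- by rewrite -(exp1n 8) ltn_exp2r.
- by rewrite muln_gt0 expn_gt0 y0.
- by rewrite muln_gt0 expn_gt0 y0.
- by rewrite leq_mul2l leq_exp2r //= leq_pmull.
- exact: halving_margins.
- exact: halving_cut.
- exact: halving_extent.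
- exact: dur1.
- exact: dur2.
- lra.
- have -> : (200 * y ^ 6).+1%N%:R = 200 * Y ^+ 6 + 1 by rewrite -natr1 natrM natrX.
  have -> : (20 * y ^ 4)%N%:R = 20 * Y ^+ 4 by rewrite natrM natrX.
  apply: lerB => //.
  have Y6 : 1 <= Y ^+ 6 by rewrite exprn_ege1 // -[1]/(1%N%:R) ler_nat.
  rewrite ler_pdivrMr; last by rewrite exprn_gt0 // mulr_gt0 // exprn_gt0.
  have -> : i ^+ 2 * (20 * Y ^+ 4) ^+ 2 = (i * Y) ^+ 2 * (400 * Y ^+ 6) by ring.
  by rewrite iY expr1n mul1r; lra.
- exact: thr0.
- lra.
- have -> : (1 / 2 - (2 * y ^ 6)%N%:R / 10 : R) = 1 / 2 - 2 * Y ^+ 6 / 10.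
    by rewrite natrM natrX.
  rewrite expRD expRN.
  set e1 := expR (1 / 2); have e1_le : e1 <= 2.
    by apply: le_trans (expR_le2 R); rewrite ler_expR; lra.
  have eY := exp_beats_power yR; set e2 := expR (2 * Y ^+ 6 / 10) in eY *.
  have Y33 : 0 < 5 * 10 ^+ 8 * Y ^+ 33 by rewrite !mulr_gt0 // exprn_gt0.
  have e2_le : e2^-1 <= i ^+ 33 / (5 * 10 ^+ 8).
    have -> : i ^+ 33 / (5 * 10 ^+ 8) = (5 * 10 ^+ 8 * Y ^+ 33)^-1.
      by rewrite [RHS]invfM [RHS]mulrC -exprVn.
    by rewrite lef_pV2 // posrE // (lt_le_trans Y33).
  have B1 : (201 * y ^ 14).+1%N%:R <= 202 * Y ^+ 14.
    have Y14 : 1 <= Y ^+ 14 by rewrite exprn_ege1 // -[1]/(1%N%:R) ler_nat.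
    by rewrite -natr1 natrM natrX -/Y; lra.
  have h1 : (201 * y ^ 14).+1%N%:R * (e1 * e2^-1) <= thr * i.
    apply: (@le_trans _ _ ((202 * Y ^+ 14) * (2 * (i ^+ 33 / (5 * 10 ^+ 8))))).
      apply: ler_pM => //; first by rewrite mulr_ge0 ?invr_ge0 ?expR_ge0.
      by apply: ler_pM => //; rewrite ?invr_ge0 expR_ge0.
    have -> : 202 * Y ^+ 14 * (2 * (i ^+ 33 / (5 * 10 ^+ 8))) =
      (i * Y) ^+ 14 * (i ^+ 18 * i * (404 / (5 * 10 ^+ 8))) by ring.
    rewrite iY expr1n mul1r /thr.
    have : 0 < i ^+ 18 * i by rewrite mulr_gt0 ?exprn_gt0.
    rewrite [i ^+ 18 / _ * i]mulrAC; move: (i ^+ 18 * i) => z; lra.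
  have h2 : 1 - i <= expR (- (2 * (201 * y ^ 14)%N%:R * (y ^ 8)%N%:R^-1 ^+ 2)).
    apply: le_trans (expR_ge1Dx _); rewrite lerD2l lerN2.
    rewrite natrM !natrX -/Y -exprVn -/i.
    have -> : 2 * (201 * Y ^+ 14) * i ^+ 8 ^+ 2 = (i * Y) ^+ 14 * (402 * i ^+ 2).
      by ring.
    by rewrite iY expr1n mul1r; lra.
  apply: le_trans (lerD (lexx _) h1) _.
  apply: (@le_trans _ _ (thr * (1 - i ^+ 2) * (1 - i))); last first.
    by rewrite ler_wpM2l // mulr_ge0 ?ltW //; lra.
  have -> : (1 - 3 * i) * thr + thr * i = thr * (1 - 2 * i) by ring.
  rewrite -mulrA ler_pM2l //.
  have i3 : 0 <= i ^+ 2 * i by rewrite mulr_ge0 ?sqr_ge0 // ltW.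
  have -> : (1 - i ^+ 2) * (1 - i) = 1 - i - i ^+ 2 + i ^+ 2 * i by ring.
  by lra.
Qed.

End Halving.

(** * The first stage *)

Section Binomial.
Variable R : realType.
Variables (q : R).
Hypothesis q01 : 0 < q <= 1 / 2.

Let q0 : 0 < q. Proof. by case/andP: q01. Qed.
Let q1 : q <= 1 / 2. Proof. by case/andP: q01. Qed.
Let p0 : 0 < 1 - q. Proof. by have := q1; lra. Qed.

Definition pmf v j : R := 'C(v, j)%:R * q ^+ j * (1 - q) ^+ (v - j).

Lemma pmf_ge0 v j : 0 <= pmf v j.
Proof. by rewrite !mulr_ge0 ?exprn_ge0 // ltW // (q0, p0). Qed.

Lemma pmfS v j : pmf v.+1 j.+1 = (1 - q) * pmf v j.+1 + q * pmf v j.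
Proof.
rewrite /pmf binS natrD subSS exprS.
have [jv|vj] := ltnP j v; first by rewrite -(subnSK jv) !exprS; ring.
rewrite bin_small // !mul0r mulr0 !add0r; ring.
Qed.

Lemma iter_avg_single k v i :
  iter v (avg q) (fun j => (j == k)%:R) i = if (i <= k)%N then pmf v (k - i) else 0.
Proof.
elim: v i => [|v IH] i /=.
  rewrite /pmf sub0n; case: ltngtP => [ik|//|->]; last by rewrite subnn bin0 !mulr1.
  by rewrite bin_small ?mul0r // subn_gt0.
rewrite /avg !IH; case: (ltngtP i k) => [ik|ki|->].
- by rewrite -(subnSK ik) pmfS.
- by rewrite !mulr0 addr0.
- by rewrite subnn /pmf !bin0 mulr0 addr0 !subn0 !expr0 !mul1r exprS.
Qed.

Lemma iter_avg_sum (J : Type) (r : seq J) (g : J -> nat -> R) v i :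
  iter v (avg q) (fun j => \sum_(a <- r) g a j) i =
  \sum_(a <- r) iter v (avg q) (g a) i.
Proof.
elim: v i => //= v IH i; rewrite /avg !IH !mulr_sumr -big_split /=.
by apply: eq_bigr.
Qed.

(** By Chebyshev the window has mass at least 3/4. If all its [2 H + 2] values were below
    [1 / (4 H)], the mass would be at most [1 / 2 + 1 / (2 H)], which is less. *)
Lemma pmf_peak v (H lo : nat) : (3 < H)%N -> 4 * (v%:R * q) <= H%:R ^+ 2 ->
  lo%:R <= v%:R * q - H%:R -> v%:R * q + H%:R <= (lo + (2 * H + 2))%N%:R ->
  exists2 j, (lo <= j < lo + (2 * H + 2))%N & 1 / (4 * H%:R) <= pmf v j.
Proof.
move=> H0 Hv lo1 lo2.
have H4 : 4 <= H%:R :> R by rewrite (ler_nat _ 4).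
set mu := v%:R * q in Hv lo1 lo2.
have [/hasP[j]|] := boolP (has (fun j => 1 / (4 * H%:R) <= pmf v j) (iota lo (2 * H + 2))).
  by rewrite mem_iota => jr pj; exists j.
move=> /hasPn small.
have q01' : 0 <= q <= 1 by have := q0; have := q1; lra.
have H0R : 0 < H%:R :> R by lra.
have := @iter_avg_window R q (fun j => lo <= j < lo + (2 * H + 2))%N v H%:R 0 q01' H0R.
rewrite add0r -/mu => win.
have {win} win : 1 - mu / H%:R ^+ 2 <=
    iter v (avg q) (fun j => (lo <= j < lo + (2 * H + 2))%N%:R) 0.
  apply: win => j; rewrite ltr_norml => /andP[j1 j2]; apply/andP; split.
    by rewrite -(ler_nat R); lra.
  by rewrite -(ltr_nat R); lra.
have e : (fun j : nat => (lo <= j < lo + (2 * H + 2))%N%:R : R) =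
         (fun j => \sum_(a <- iota lo (2 * H + 2)) (j == a)%:R).
  apply/funext => j; rewrite -mem_iota.
  have [jin|jnot] := boolP (j \in _).
    rewrite (bigD1_seq j) ?iota_uniq //= eqxx big1 ?addr0 // => a aj.
    by rewrite eq_sym (negPf aj).
  rewrite big_seq big1 // => a ain; case: eqP => // ja; by rewrite ja ain in jnot.
rewrite e iter_avg_sum in win.
have : \sum_(a <- iota lo (2 * H + 2)) iter v (avg q) (fun j => (j == a)%:R) 0 <=
       \sum_(a <- iota lo (2 * H + 2)) 1 / (4 * H%:R).
  rewrite big_seq [leRHS]big_seq; apply: ler_sum => a ain.
  by rewrite iter_avg_single leq0n subn0 ltW // ltNge; exact: small.
rewrite big_const_seq iter_addr_0 count_predT size_iota -mulr_natl => up.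
have m4 : mu / H%:R ^+ 2 <= 1 / 4 by rewrite ler_pdivrMr ?exprn_gt0 //; lra.
have up2 : (2 * H + 2)%N%:R * (1 / (4 * H%:R)) < 3 / 4 :> R.
  by rewrite mulrA mulr1 ltr_pdivrMr ?mulr_gt0 // natrD natrM; lra.
by lra.
Qed.

Lemma pmf_ratio v j :
  pmf v j.+1 * (j.+1%:R * (1 - q)) = pmf v j * ((v - j)%N%:R * q).
Proof.
have [jv|vj] := ltnP j v; last first.
  by rewrite /pmf bin_small // (eqP vj) !mul0r !mulr0.
have := congr1 (fun n => n%:R : R) (mul_bin_left v j); rewrite /pmf !natrM => e.
rewrite -(subnSK jv) in e *; rewrite !exprS.
transitivity (j.+1%:R * 'C(v, j.+1)%:R * (q * q ^+ j * (1 - q) * (1 - q) ^+ (v - j.+1))).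
  by ring.
by rewrite e; ring.
Qed.

Section Chain.
Variables (v h : nat).
Let mu : R := v%:R * q.
Let d : R := 4 * h.+1%:R / mu.
Hypotheses (mu0 : 0 < mu) (d2 : d <= 1 / 2).

Let inside (j : nat) := `|j%:R - mu| <= h%:R.

Let d0 : 0 <= d. Proof. by rewrite divr_ge0 ?mulr_ge0 // ltW. Qed.
Let hmu : 8 * h.+1%:R <= mu.
Proof. by have := d2; rewrite /d ler_pdivrMr //; lra. Qed.
Let dmu : d * mu = 4 * h.+1%:R.
Proof. by rewrite /d divfK // lt0r_neq0. Qed.

(** Neighbouring probabilities are in the ratio of [(j + 1) (1 - q)] to [mu - j q]. These numbers
    differ by at most [h + 1], and both are at least [mu / 4]. *)
Lemma pmf_step j : inside j -> inside j.+1 ->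
  (1 - d) * pmf v j <= pmf v j.+1 /\ (1 - d) * pmf v j.+1 <= pmf v j.
Proof.
rewrite /inside !ler_norml -!natr1 => /andP[j1 j2] /andP[j3 j4].
have h1 : h.+1%:R = h%:R + 1 :> R by rewrite natr1.
have hm := hmu; have dm := dmu; have q0' := q0; have q1' := q1; have d0' := d0; have d2' := d2.
rewrite h1 in hm dm.
have h0 : 0 <= h%:R :> R by [].
have jvR : j%:R < v%:R :> R.
  have : mu <= v%:R * (1 / 2) by rewrite ler_wpM2l.
  by lra.
have jv : (j < v)%N by rewrite -(ltr_nat R).
have vj : (v - j)%N%:R * q = mu - j%:R * q by rewrite natrB 1?ltnW // mulrBl.
have := pmf_ratio v j; rewrite vj -natr1.
have P0 := pmf_ge0 v j; have P1 := pmf_ge0 v j.+1.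
set a := (_ + 1) * _; set b := mu - _ => ratio.
have jq : j%:R * q <= j%:R * (1 / 2) by rewrite ler_wpM2l.
have jq' : (j%:R + 1) * q <= (j%:R + 1) * (1 / 2) by rewrite ler_wpM2l //; lra.
have jq0 : 0 <= j%:R * q by rewrite mulr_ge0 // ltW.
have ae : a = (j%:R + 1) - (j%:R + 1) * q by rewrite /a; ring.
have amu : mu / 4 <= a by rewrite ae; lra.
have bmu : mu / 4 <= b by rewrite /b; lra.
have da : h%:R + 1 <= d * a.
  apply: le_trans (_ : d * (mu / 4) <= _); last by rewrite ler_wpM2l.
  by rewrite mulrA dm; lra.
have db : h%:R + 1 <= d * b.
  apply: le_trans (_ : d * (mu / 4) <= _); last by rewrite ler_wpM2l.
  by rewrite mulrA dm; lra.
have b_low : (1 - d) * a <= b.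
  have : a - b <= h%:R + 1 by rewrite ae /b; lra.
  by rewrite mulrBl mul1r; lra.
have a_low : (1 - d) * b <= a.
  have : b - a <= h%:R + 1 by rewrite ae /b; lra.
  by rewrite mulrBl mul1r; lra.
have a0 : 0 < a by apply: lt_le_trans amu; rewrite divr_gt0.
have b0 : 0 < b by apply: lt_le_trans bmu; rewrite divr_gt0.
split.
- by rewrite -(ler_pM2r a0) ratio mulrAC [leRHS]mulrC ler_wpM2r.
- by rewrite -(ler_pM2r b0) -ratio mulrAC [leRHS]mulrC ler_wpM2r.
Qed.

Lemma inside_mid j n m : inside j -> inside (j + n)%N -> (m <= n)%N ->
  inside (j + m)%N.
Proof.
rewrite /inside !ler_norml !natrD -(ler_nat R) => /andP[j1 j2] /andP[j3 j4] mn.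
have : 0 <= m%:R :> R by [].
by move=> m0; apply/andP; split; lra.
Qed.

Lemma pmf_chain j n : inside j -> inside (j + n)%N ->
  (1 - d) ^+ n * pmf v j <= pmf v (j + n) /\
  (1 - d) ^+ n * pmf v (j + n) <= pmf v j.
Proof.
have d2' := d2; have e0 : 0 <= 1 - d by lra.
elim: n => [|n IH] ij ijn; first by rewrite addn0 !mul1r.
have ijn' := inside_mid ij ijn (leqnSn n).
have [h1 h2] := IH ij ijn'; rewrite addnS in ijn *.
have [h3 h4] := pmf_step ijn' ijn.
split.
- by apply: le_trans h3; rewrite exprS -mulrA ler_wpM2l.
- apply: le_trans h2; rewrite exprSr -mulrA ler_wpM2l // exprn_ge0 //.
Qed.

(** At most [2 h] neighbouring steps are needed, each costing a factor [1 - d >= e ^ (- 2 d)]. *)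
Lemma pmf_near j j' : inside j -> inside j' ->
  expR (- (4 * h%:R * d)) * pmf v j <= pmf v j'.
Proof.
have d2' := d2; have d0' := d0.
have e0 : 0 <= 1 - d by lra.
have ed : expR (- (2 * d)) <= 1 - d.
  rewrite expRN -[leRHS]invrK lef_pV2 ?posrE ?invr_gt0 ?expR_gt0 //; last lra.
  apply: (@le_trans _ _ (1 + 2 * d)); last exact: expR_ge1Dx.
  rewrite -div1r ler_pdivrMr; last lra.
  have : d * d <= d * (1 / 2) by rewrite ler_wpM2l.
  have -> : (1 + 2 * d) * (1 - d) = 1 + d - 2 * (d * d) by ring.
  by lra.
have key n : n%:R <= 2 * h%:R :> R -> expR (- (4 * h%:R * d)) <= (1 - d) ^+ n.
  move=> nh; apply: (@le_trans _ _ (expR (- (2 * d)) ^+ n)); last first.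
    by rewrite lerXn2r ?nnegrE ?expR_ge0.
  rewrite -expRM_natl ler_expR mulrN lerN2.
  have : n%:R * d <= 2 * h%:R * d by rewrite ler_wpM2r.
  have -> : n%:R * (2 * d) = 2 * (n%:R * d) by ring.
  have -> : 4 * h%:R * d = 2 * (2 * h%:R * d) by ring.
  by lra.
have dist i i' : inside i -> inside i' -> i'%:R - i%:R <= 2 * h%:R :> R.
  by rewrite /inside !ler_norml => /andP[? ?] /andP[? ?]; lra.
move=> ij ij'; have [jj'|j'j] := leqP j j'.
  have [n e] : exists n, j' = (j + n)%N by exists (j' - j)%N; rewrite subnKC.
  rewrite e in ij' *; apply: le_trans (pmf_chain ij ij').1.
  rewrite ler_wpM2r ?pmf_ge0 //; apply: key.
  by have := dist _ _ ij ij'; rewrite natrD; lra.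
have [n e] : exists n, j = (j' + n)%N by exists (j - j')%N; rewrite subnKC // ltnW.
rewrite e in ij *; apply: le_trans (pmf_chain ij' ij).2.
rewrite ler_wpM2r ?pmf_ge0 //; apply: key.
by have := dist _ _ ij' ij; rewrite natrD; lra.
Qed.

End Chain.

(** A weak local limit theorem: some point near the mean has mass [1 / (4 H)], and the mass varies
    slowly around it. *)
Lemma binomial_lower v H j : let mu := v%:R * q in
  (3 < H)%N -> 4 * mu <= H%:R ^+ 2 -> 8 * (H + 3)%N%:R <= mu ->
  `|j%:R - mu| <= (H + 2)%N%:R ->
  expR (- (16 * (H + 3)%N%:R ^+ 2 / mu)) / (4 * H%:R) <= pmf v j.
Proof.
move=> mu H3 Hmu muH jmu.
have H0 : 0 < H%:R :> R by rewrite ltr0n; lia.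
have mu0 : 0 < mu by apply: lt_le_trans muH; rewrite mulr_gt0 // ltr0n addn3.
have muH' : 0 <= mu - H%:R by move: muH; rewrite natrD; lra.
have /andP[tr1 tr2] := truncn_itv muH'.
have [||j0 /andP[j01 j02] peak] := pmf_peak (lo := Num.truncn (mu - H%:R)) H3 Hmu.
- exact: tr1.
- by move: tr2; rewrite -/mu !natrD -natr1; lra.
have d2 : 4 * (H + 2).+1%:R / mu <= 1 / 2 by rewrite ler_pdivrMr // -addnS; lra.
have ij0 : `|j0%:R - mu| <= (H + 2)%N%:R.
  move: j01 j02 tr1 tr2; rewrite -(ler_nat R) -(ltr_nat R) !natrD -natr1.
  by rewrite ler_norml => *; apply/andP; split; lra.
apply: le_trans (pmf_near mu0 d2 ij0 jmu).
apply: ler_pM; rewrite ?expR_ge0 ?invr_ge0 ?mulr_ge0 //.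
  rewrite ler_expR lerN2.
  have -> : (H + 2).+1 = (H + 3)%N by rewrite -addnS.
  have -> : 16 * (H + 3)%N%:R ^+ 2 / mu = 4 * (H + 3)%N%:R * (4 * (H + 3)%N%:R / mu) by ring.
  apply: ler_wpM2r; first by rewrite divr_ge0 ?mulr_ge0 // ltW.
  by rewrite ler_wpM2l // ler_nat leq_add2l.
by move: peak; rewrite div1r.
Qed.

End Binomial.

(** * The chain of stages and its end *)

Section Ends.
Variable R : realType.

Lemma force_chain (Q : nat -> counts -> counts -> Prop) (p n : nat) L0 R0 :
  upclosed (Q p) ->
  (forall m L1 R1, (p <= m)%N -> Q m.+1 L1 R1 -> force (Q m) L1 R1) ->
  Q (p + n)%N L0 R0 -> force (Q p) L0 R0.
Proof.
move=> upQ step; elim: n L0 R0 => [|n IH] L0 R0.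
  by rewrite addn0 => h; apply: ForceDone.
by rewrite addnS => /step st; apply: force_bind IH (st _) => //; exact: leq_addr.
Qed.

Definition scale (K : R) (x : nat) := stage (2 * x ^ 6) (width x) (level K x%:R).

Lemma descend (K : R) (p n : nat) L0 R0 : 1 <= K -> 10 ^+ 6 <= (2 ^ p)%N%:R :> R ->
  scale K (2 ^ (p + n)) L0 R0 -> force (scale K (2 ^ p)) L0 R0.
Proof.
move=> K1 hp st.
apply: (@force_chain (fun m => scale K (2 ^ m)) p n) st.
  exact: upclosed_stage.
move=> m L1 R1 pm; rewrite expnS; apply: halving K1 _.
by apply: le_trans hp _; rewrite ler_nat leq_exp2l.
Qed.

(** Such a density makes both groups at the window ends large enough for [crude_win]; the extra
    factor 2 makes up for [e ^ (- 1 / 2)]. *)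
Lemma dense_item_wins (S w : nat) (it : item R) (L0 R0 : counts) : (0 < w)%N ->
  valid S it -> 2 * 2 ^+ (S + 10) <= dens it -> contains w it L0 R0 ->
  force nowhere L0 R0.
Proof.
move=> w0 [l0 r0 /andP[S1 S2] d0 bal] dit [hL hR].
have e2 : 1 / 2 <= expR (- (1 / 2)) :> R.
  by apply: le_trans (expR_ge1Dx _); lra.
have e0 : 1 <= expR (S%:R / 10) :> R by rewrite -[leLHS]expR0 ler_expR divr_ge0.
have size D s : expR (S%:R / 10 - 1 / 2) <= 2 ^+ D * expR s ->
    (2 ^ (lpos it + rpos it))%N%:R <= 2 ^+ D * (dens it * expR s).
  rewrite expRD => g; rewrite mulrCA natrX.
  apply: (@le_trans _ _ (2 ^+ (S + 10))); first by rewrite ler_weXn2l // ler1n.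
  apply: (@le_trans _ _ (2 * 2 ^+ (S + 10) * (1 / 2))); first by rewrite mulrAC; lra.
  apply: ler_pM; rewrite ?divr_ge0 ?mulr_ge0 ?exprn_ge0 //.
  apply: le_trans g; apply: le_trans e2 _.
  by rewrite ler_peMl ?expR_ge0.
have [b1 b2] : (rpos it)%:R - (lpos it)%:R - 2 * tilt it <= 1 /\
               (lpos it)%:R - (rpos it)%:R - 2 * (- tilt it) <= 1.
  by move: bal; rewrite ler_norml => /andP[? ?]; split; lra.
have in_window D : (D <= D < D + w)%N by rewrite leqnn -[ltnLHS]addn0 ltn_add2l.
apply: (@crude_win (lpos it) (rpos it)); rewrite -(ler_nat R).
- apply: le_trans (hL (lpos it)).
  rewrite /lcover /window_count in_window.
  by apply: size; apply: group_size b1.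
- apply: le_trans (hR (rpos it)).
  rewrite /rcover /window_count in_window.
  by apply: size; apply: group_size b2 => //; rewrite addnC.
Qed.

(** With a total density above what merging can drop, one dense item must survive. *)
Lemma heavy_stage_wins (S w : nat) : (0 < w)%N -> exists2 c : R, 0 < c &
  forall L0 R0, stage S w c L0 R0 -> force nowhere L0 R0.
Proof.
move=> w0; pose thr : R := 2 * 2 ^+ (S + 10).
have thr0 : 0 < thr by rewrite mulr_gt0 ?exprn_gt0.
exists ((S + 11)%:R ^+ 2 * thr + 1).
  by rewrite ltr_wpDl // mulr_ge0 ?sqr_ge0 // ltW.
move=> L0 R0 [l [lS cl lL lR]].
have [[|it l'] [l'S cl' hl']] := merge_drop w thr0 lS.
  by move: cl'; rewrite big_nil => cl'; exfalso; lra.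
have [vit dit] := l'S it (mem_head _ _).
have d_ge0 it' : it' \in l' -> 0 <= dens it'.
  move=> it'l; have : it' \in it :: l' by rewrite inE it'l orbT.
  by case/l'S => -[_ _ _ /ltW].
apply: (dense_item_wins w0 vit dit); split=> i.
  apply: le_trans (lL i); apply: le_trans (hl' i).1; rewrite /lsum big_cons.
  rewrite lerDl big_seq; apply: sumr_ge0 => it' it'l.
  by rewrite window_count_ge0 // mulr_ge0 ?expR_ge0 // d_ge0.
apply: le_trans (lR i); apply: le_trans (hl' i).2; rewrite /rsum big_cons.
rewrite lerDl big_seq; apply: sumr_ge0 => it' it'l.
by rewrite window_count_ge0 // mulr_ge0 ?expR_ge0 // d_ge0.
Qed.

Lemma final_stage (x : nat) : (100 < x)%N -> exists2 K : R, 1 <= K &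
  forall L0 R0, scale K x L0 R0 -> force nowhere L0 R0.
Proof.
move=> x1; have w0 : (0 < width x)%N by rewrite muln_gt0 expn_gt0 subn_gt0 x1; lia.
have [c c0 hc] := heavy_stage_wins (2 * x ^ 6) w0.
have X1 : 101 <= x%:R :> R by rewrite (ler_nat _ 101).
exists (1 + c * x%:R ^+ 5); first by rewrite lerDl mulr_ge0 ?exprn_ge0 // ltW.
move=> L0 R0 st; apply: hc; apply: stage_weaken st.
have x5 : 0 < x%:R ^+ 5 :> R by rewrite exprn_gt0 //; lra.
rewrite /level ler_pdivlMr // .
have : 1 <= 2 - 100 / x%:R :> R.
  rewrite lerBrDl -lerBrDr ler_pdivrMr; lra.
have : 0 < c * x%:R ^+ 5 by rewrite mulr_gt0.
move: (c * _) (2 - _) => u v u0 v1.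
have : u * 1 <= u * v by rewrite ler_pM2l.
by rewrite mulrDl; lra.
Qed.

End Ends.

(** * From all edges at distance [k] to the first windows *)

Section Start.
Variable R : realType.

(** Since [k <= 1024 * a ^ 2], the deviation [H = 65 * a] exceeds twice the root of [mu]. The
    exponent [16 (H + 3) ^ 2 / mu] is bounded because [mu] is close to [k]. *)
Lemma window_bound_single (k T t S w H : nat) (a b c : R) : (3 < T)%N ->
  1000 <= a -> 1000 * a <= b -> 1000 * b <= c -> c = a ^+ 2 ->
  c <= k%:R <= 1024 * c -> S%:R = 2 * b -> w%:R <= a -> H%:R = 65 * a ->
  ((k + k) * T.+1 < S.+1 * T.+1 + 2 * t)%N ->
  window_bound T k k t w (expR (- (2 * 10 ^+ 5)) / (260 * a))
    (fun j => (j == k)%:R).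
Proof.
move=> T3 a0 ab bc ca /andP[ck kc] Sb wa Ha tS v i v1 v2 v3 v4.
set q : R := 2 / T.+1%:R.
pose mu := v%:R * q.
have T0 : 0 < T.+1%:R :> R by rewrite ltr0n.
have q01 : 0 < q <= 1 / 2.
  have T5 : 4 <= T.+1%:R :> R by rewrite (ler_nat _ 4) ltnW.
  by rewrite divr_gt0 //= /q ler_pdivrMr // -ler_pdivrMl //; lra.
have muT : mu * T.+1%:R = v%:R * 2 by rewrite /mu -mulrA /q divfK // lt0r_neq0.
have h1 : mu <= k%:R + 1.
  move: v1; rewrite -(ler_pM2r T0) muT -(ler_nat R) natrD !natrM mulrDl mul1r.
  by have : 2 <= T.+1%:R :> R by [rewrite (ler_nat _ 2) ltnS (ltnW (ltnW (ltnW T3)))]; move: (k%:R * _) => *; lra.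
have h2 : k%:R <= i%:R + mu.
  move: v3; rewrite -(ler_pM2r T0) mulrDl muT -(ler_nat R) natrD !natrM.
  by [].
have h3 : i%:R + mu <= k%:R + w%:R + 3.
  move: v4; rewrite -(ler_pM2r T0) [leLHS]mulrDl muT -(ler_nat R) natrD !natrM !natrD.
  by [].
(* The other side can contribute at most [k] to the total travel, so this side has travelled at
   least [k - 2 b - 1] on average. *)
have h4 : k%:R + k%:R <= 2 * b + 1 + mu + k%:R.
  rewrite -(ler_pM2r T0) ![in leRHS]mulrDl muT; move: v2 tS.
  rewrite -(ler_nat R) -(ltr_nat R) !natrD !natrM natrD -[S.+1%:R]natr1 Sb.
  by clear - T0; lra.
clear v1 v2 v3 v4 tS muT.
have ik : (i <= k)%N by rewrite -(ler_nat R); clear - a0 ab bc ck h3 h4 wa; lra.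
rewrite iter_avg_single ik.
have HH : (3 < H)%N by rewrite -(ltr_nat R) Ha; clear - a0; lra.
apply: le_trans (binomial_lower q01 HH _ _ _).
- have -> : 4 * H%:R = 260 * a by rewrite Ha; clear; lra.
  rewrite ler_wpM2r ?invr_ge0 ?mulr_ge0 //; first by clear - a0; lra.
  rewrite -/mu ler_expR lerN2 ler_pdivrMr; last by clear - a0 ab bc ck h4; lra.
  rewrite natrD Ha.
  apply: (@le_trans _ _ (16 * (66 * a) ^+ 2)).
    by rewrite ler_wpM2l // lerXn2r ?nnegrE //; clear - a0; lra.
  by rewrite exprMn -ca; clear - a0 ab bc ck h4; lra.
- by rewrite Ha exprMn -ca -/mu; clear - a0 ab bc kc h1; lra.
- by rewrite natrD Ha -/mu; clear - a0 ab bc ck h4; lra.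
- rewrite natrB // !natrD Ha -/mu ler_norml.
  by apply/andP; split; clear - a0 h2 h3 wa; lra.
Qed.

Lemma start_loss (X K t S : R) : 10 ^+ 6 <= X -> 1 <= K -> S = 2 * X ^+ 6 ->
  0 <= t <= 5000 * X ^+ 22 -> t * expR (1 / 2 - S / 10) <= K / X ^+ 5.
Proof.
move=> hX K1 -> /andP[t0 t1].
have X0 : 0 < X by apply: lt_le_trans hX; rewrite exprn_gt0.
rewrite expRD expRN.
set e1 := expR (1 / 2); have e1_le : e1 <= 2.
  by apply: le_trans (expR_le2 R); rewrite ler_expR; clear; lra.
have eX := exp_beats_power hX; set e2 := expR (2 * X ^+ 6 / 10) in eX *.
have X33 : 0 < X ^+ 33 by rewrite exprn_gt0.
have e2_le : e2^-1 <= (X ^+ 33)^-1.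
  rewrite lef_pV2 ?posrE ?expR_gt0 //; apply: le_trans eX.
  by rewrite ler_peMl ?(ltW X33) //; clear; lra.
apply: (@le_trans _ _ (5000 * X ^+ 22 * (2 * (X ^+ 33)^-1))).
  apply: ler_pM => //; first by rewrite mulr_ge0 ?invr_ge0 ?expR_ge0.
  by apply: ler_pM => //; rewrite ?invr_ge0 expR_ge0.
have -> : 5000 * X ^+ 22 * (2 * (X ^+ 33)^-1) = (10 ^+ 4 / X ^+ 6) / X ^+ 5.
  by field; rewrite lt0r_neq0.
rewrite ler_wpM2r ?invr_ge0 ?exprn_ge0 ?(ltW X0) //.
rewrite ler_pdivrMr ?exprn_gt0 //.
apply: (@le_trans _ _ (1 * X)); last first.
  apply: ler_pM => //; first exact: ltW.
  have X1 : 1 <= X by apply: le_trans hX; clear; lra.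
  by rewrite -[leLHS]expr1 ler_weXn2l.
by rewrite mul1r; apply: le_trans hX; clear; lra.
Qed.

Lemma powers (X : R) : 10 ^+ 6 <= X -> [/\ 1000 <= X ^+ 5, 1000 * X ^+ 5 <= X ^+ 6,
  1000 * X ^+ 6 <= X ^+ 10 & 10 ^+ 6 * X ^+ 10 <= X ^+ 12].
Proof.
move=> hX; have X3 : 1000 <= X by apply: le_trans hX; clear; lra.
have X0 : 0 <= X by clear - X3; lra.
have h4 n : 1 <= X ^+ n by rewrite exprn_ege1 //; clear - X3; lra.
have step n m : 1000 * X ^+ n <= X ^+ (n.+1 + m).
  rewrite exprD exprS -[leLHS]mulr1.
  by apply: ler_pM; rewrite ?mulr_ge0 ?exprn_ge0 ?ler_wpM2r ?exprn_ge0.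
split; [|exact: step 5 0|exact: step 6 3|].
- by have := step 0%N 4%N; rewrite mulr1.
- rewrite (exprD X 2 10) ler_wpM2r ?exprn_ge0 //.
  by rewrite (exprM _ 3 2) lerXn2r ?nnegrE ?exprn_ge0 //; apply: le_trans X3; clear; lra.
Qed.

Lemma width_le x : (width x)%:R <= x%:R ^+ 5 :> R.
Proof. by rewrite -natrX ler_nat /width (expnSr x 4) leq_mul2l leq_subr orbT. Qed.

(** A single pair of windows with tilt 0 is produced. In [780 = 3 * 260], the 260 comes from the
    binomial bound; of the 3, two parts cover [level] and one the rounding error. *)
Lemma first_stage (x k n : nat) (K : R) : 10 ^+ 6 <= x%:R :> R ->
  x%:R ^+ 10 <= (k%:R : R) <= 1024 * x%:R ^+ 10 -> 1 <= K ->
  780 * expR (2 * 10 ^+ 5 + 1) * K * 2 ^+ k <= n%:R ->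
  force (scale K x) (single k n) (single k n).
Proof.
set X : R := x%:R; move=> hX /andP[kX Xk] K1 hn.
have [X5 X6 X10 X12] := powers hX.
have X3 : 1000 <= X by apply: le_trans hX; clear; lra.
have X0 : 0 < X by clear - X3; lra.
have x0 : (0 < x)%N by rewrite -(ltr_nat R).
(* There are at most [2048 X ^ 10 T] rounds, so [T = x ^ 12] keeps [4 t] below [T ^ 2]. *)
have [T Tx] : exists T, T = (x ^ 12)%N by exists (x ^ 12)%N.
have [S Sx] : exists S, S = (2 * x ^ 6)%N by exists (2 * x ^ 6)%N.
have TX : T%:R = X ^+ 12 :> R by rewrite Tx natrX.
have SE : S%:R = 2 * X ^+ 6 :> R by rewrite Sx natrM natrX.
have T3 : (3 < T)%N by rewrite -(ltr_nat R) TX; clear - X5 X6 X10 X12; lra.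
have T0 : 0 < T%:R :> R by rewrite ltr0n; apply: leq_trans T3.
have T1 : T.+1%:R <= 2 * T%:R :> R.
  by rewrite -natr1 TX; clear - X5 X6 X10 X12; lra.
have SX : (S <= k + k)%N.
  by rewrite -(ler_nat R) SE natrD; clear - X5 X6 X10 kX; lra.
have [] := travel_time (ltnW (ltnW (ltnW T3))) SX; set t := (_ %/ 2)%N => t1 t2 t3.
have t4 : 2 * t%:R <= 4096 * X ^+ 10 * T%:R :> R.
  move: t3; rewrite -(ler_nat R) !natrM natrD => t3; apply: (le_trans t3).
  apply: (@le_trans _ _ ((k%:R + k%:R) * (2 * T%:R))).
    by rewrite ler_wpM2l // addr_ge0.
  rewrite [leLHS]mulrA; apply: ler_wpM2r; first exact: ltW.
  by clear - Xk; lra.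
have tT : 4 * t%:R <= T%:R ^+ 2 :> R.
  rewrite expr2; apply: (@le_trans _ _ (8192 * X ^+ 10 * T%:R)).
    by clear - t4; lra.
  by rewrite ler_pM2r // TX; clear - X5 X6 X10 X12; lra.
pose rho : R := n%:R / 2 ^+ k.
have rho0 : 0 <= rho by rewrite divr_ge0 ?exprn_ge0.
have rho_low : 780 * expR (2 * 10 ^+ 5 + 1) * K <= rho.
  by rewrite /rho ler_pdivlMr ?exprn_gt0.
set e := expR (- (2 * 10 ^+ 5)) / (260 * X ^+ 5) : R.
have e0 : 0 <= e by rewrite divr_ge0 ?expR_ge0 ?mulr_ge0 ?exprn_ge0 ?(ltW X0).
have wb : window_bound T k k t (width x) e (fun j => (j == k)%:R).
  apply: (@window_bound_single k T t S (width x) (65 * x ^ 5) _ (X ^+ 6) (X ^+ 10)) => //.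
  - by rewrite -exprM.
  - by rewrite kX.
  - exact: width_le.
  - by rewrite natrM natrX.
have [Ki0 level_le] : 0 < 100 / X <= 1 /\ level K X <= 2 * K / X ^+ 5.
  have d : 0 < 100 / X <= 1.
    by rewrite divr_gt0 //= ler_pdivrMr //; clear - X3; lra.
  split=> //; rewrite /level ler_wpM2r ?invr_ge0 ?exprn_ge0 ?(ltW X0) //.
  by rewrite mulrC ler_wpM2r ?(le_trans _ K1) // lerBlDr lerDl; case/andP: d => /ltW.
have level_gt0 : 0 < level K X.
  rewrite /level divr_gt0 ?exprn_gt0 // mulr_gt0 ?(lt_le_trans _ K1) //.
  by move: (100 / X) Ki0 => z; clear; lra.
have loss1 : 2 * t%:R * T%:R^-1 ^+ 2 <= 1 :> R.
  rewrite exprVn ler_pdivrMr ?exprn_gt0 // mul1r; apply: le_trans tT.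
  by rewrite ler_wpM2r // ler_nat.
have goal_rho : level K X + t.+1%:R * expR (1 / 2 - S%:R / 10) <=
    rho * e * expR (- (2 * t%:R * T%:R^-1 ^+ 2)).
  apply: (@le_trans _ _ (3 * K / X ^+ 5)).
    have -> : 3 * K / X ^+ 5 = 2 * K / X ^+ 5 + K / X ^+ 5 by rewrite -mulrDl; congr (_ / _); clear; lra.
    apply: lerD level_le _; apply: start_loss => //.
    rewrite ler0n -natr1 (exprD X 10 12) -TX.
    have : 1 <= X ^+ 10 * T%:R.
      apply: (@le_trans _ _ (1 * 1)); first by rewrite mul1r.
      by apply: ler_pM => //; [clear - X5 X6 X10; lra | rewrite ler1n ltnW // ltnW // ltnW].
    have : 0 <= t%:R :> R by [].
    by move: t4; rewrite -[leRHS]mulrA; move: (X ^+ 10 * _) t%:R => z t'; clear; lra.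
  apply: (@le_trans _ _ (rho * e * expR (-1))); last first.
    apply: ler_wpM2l; first exact: mulr_ge0.
    by rewrite ler_expR lerN2.
  have E : expR (2 * 10 ^+ 5 + 1) * (expR (- (2 * 10 ^+ 5)) * expR (-1)) = 1 :> R.
    by rewrite -!expRD -opprD subrr expR0.
  apply: (@le_trans _ _ (780 * expR (2 * 10 ^+ 5 + 1) * K * e * expR (-1))).
    apply: (@le_trans _ _ (3 * K / X ^+ 5 *
      (expR (2 * 10 ^+ 5 + 1) * (expR (- (2 * 10 ^+ 5)) * expR (-1))))).
      by rewrite E mulr1.
    rewrite /e; move: (expR (2 * _ + _)) (expR (- (_ * _))) (expR (-1)) => u v w.
    by rewrite le_eqVlt; apply/orP; left; apply/eqP; field; rewrite lt0r_neq0.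
  by rewrite ler_wpM2r ?expR_ge0 // ler_wpM2r.
rewrite /scale -Sx; apply: (@force_bind (fun L R' => exists it : item R,
  [/\ valid S it, dens it = level K X & contains (width x) it L R'])).
- exact: upclosed_stage.
- move=> L M [it [vit dit [itL itM]]]; apply: ForceDone; exists [:: it]; split.
  + by move=> it'; rewrite inE => /eqP ->.
  + by rewrite big_seq1 dit.
  + by move=> i; rewrite /lsum big_seq1.
  + by move=> i; rewrite /rsum big_seq1.
have start s : s = 0 -> forall i,
    2 ^+ i * (rho * expR s) * (i == k)%:R - 1 <= (single k n i)%:R.
  move=> -> i; rewrite expR0 mulr1 /single; case: eqP => [->|_]; last first.
    by rewrite mulr0 sub0r lerN10.
  rewrite mulr1 mulrC /rho divfK ?lt0r_neq0 ?exprn_gt0 //.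
  by rewrite lerBlDr lerDl.
apply: (@travel R T k k t S (width x) (fun j => (j == k)%:R) (fun j => (j == k)%:R)
  e rho (level K X) 0) => //.
- by rewrite ltnW // ltnW.
- by rewrite Sx muln_gt0 expn_gt0 x0.
- by rewrite -(ler_nat R) natrM natrX.
- by rewrite subrr mulr0 subrr normr0.
- exact: start.
- by apply: start; rewrite oppr0.
Qed.

End Start.

(** * The two bounds on [mOL] *)

Local Open Scope nat_scope.

Lemma mOL_ge k : 2 ^ k <= 2 * mOL k.
Proof.
rewrite /mOL; case: ex_minnP => N /asboolP[P winP] _.
rewrite leqNgt; apply/negP => /(colorer_survives P)[C survC].
by have [n [won _]] := winP C; have := survC n; rewrite won.
Qed.

Lemma mOL_le k N : presenter_wins k N -> mOL k <= N.
Proof.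
by move=> win; rewrite /mOL; case: ex_minnP => m _; apply; apply/asboolP.
Qed.

Local Open Scope ring_scope.

Lemma mOL_upper (R : realType) : exists C : R, exists k0 : nat,
  forall k, (k0 <= k)%N -> (mOL k)%:R <= C * 2 ^+ k.
Proof.
have [p hp] : exists p, 10 ^+ 6 <= (2 ^ p)%N%:R :> R.
  by exists 20%N; rewrite natrX; lra.
have p100 : (100 < 2 ^ p)%N.
  rewrite -(ltr_nat R); apply: lt_le_trans hp.
  by rewrite -[100%N]/(10 ^ 2)%N natrX ltr_eXn2l //; lra.
have [K K1 win] := final_stage R p100.
pose A : R := 780 * expR (2 * 10 ^+ 5 + 1) * K.
have A0 : 0 <= A by rewrite !mulr_ge0 ?expR_ge0 //; lra.
exists (2 * A + 2), ((2 ^ 10) ^ p)%N => k pk.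
have k0 : (0 < k)%N by apply: leq_trans pk; rewrite !expn_gt0.
have b1 : (1 < 2 ^ 10)%N by rewrite -[1%N]/(2 ^ 0)%N ltn_exp2l.
(* With [x = 2 ^ m] this is [x ^ 10 <= k < 1024 * x ^ 10], so a power of two serves as the first
   scale for every [k]. *)
have /andP[] := trunc_log_bounds b1 k0; set m := trunc_log _ k => mk km.
have pm : (p <= m)%N by rewrite -ltnS -(ltn_exp2l _ _ b1); apply: leq_ltn_trans pk km.
have hx : ((2 ^ 10) ^ m)%N%:R = (2 ^ m)%N%:R ^+ 10 :> R.
  by rewrite -natrX -!expnM mulnC.
pose n := (Num.truncn (A * 2 ^+ k)).+1.
have /andP[n1 n2] : (Num.truncn (A * 2 ^+ k))%:R <= A * 2 ^+ k < n%:R.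
  by apply: truncn_itv; rewrite mulr_ge0 ?exprn_ge0.
have f : force nowhere (single k n) (single k n).
  apply: (force_bind upclosed_nowhere win).
  have hm : (2 ^ p <= 2 ^ m)%N by rewrite leq_exp2l.
  apply: (@force_bind (scale K (2 ^ m))).
  - exact: upclosed_stage.
  - by move=> L0 R0; rewrite -(subnKC pm); apply: descend.
  - apply: (@first_stage R _ k n K) => //; last exact: ltW.
      by apply: le_trans hp _; rewrite ler_nat.
    rewrite -hx ler_nat mk /=.
    have -> : 1024 = (2 ^ 10)%N%:R :> R by clear; rewrite natrX; lra.
    by rewrite -natrM -expnS ler_nat ltnW.
have := mOL_le (presenter_wins_of_force f); rewrite -(ler_nat R) => le.
apply: le_trans le _; rewrite /n natrD -natr1.
have : 1 <= 2 ^+ k :> R by rewrite exprn_ege1 // ler1n.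
by move: n1; rewrite mulrDl; clear; lra.
Qed.

Import numFieldNormedType.Exports.
Local Open Scope classical_set_scope.
Local Open Scope ring_scope.

Theorem corollary3 (R : realType) :
  (fun k : nat => (mOL k)%:R : R) =Theta_\oo (fun k : nat => 2 ^+ k : R).
Proof.
rewrite eqThetaE qualifE; apply/asboolP.
have [C [k0 hC]] := mOL_upper R.
(* Both constants must be positive, which is not known of [C] itself. *)
exists (1 / 2, `|C| + 1) => /=; first by rewrite divr_gt0 //= ltr_wpDl.
exists k0 => // k /= k0k.
have e : 0 < 2 ^+ k :> R by rewrite exprn_gt0.
rewrite (ger0_norm (ltW e)) ger0_norm //; split.
  by have := mOL_ge k; rewrite -(ler_nat R) natrM natrX; lra.
apply: le_trans (hC k k0k) _; rewrite ler_wpM2r ?(ltW e) //.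
by apply: le_trans (ler_norm C) _; rewrite lerDl.
Qed.
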